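(* Let $a,b$ be coprime positive integers and $n\ge1$. On the set of $(a,b)$-Dyck paths of size $n$, rowmotion is congruent to inverse promotion up to the matching map: $$\mathrm{Mat}\circ\delta=\partial^{-1}\circ\mathrm{Mat}.$$
   Context: An $(a,b)$-Dyck path of size $n$ is a lattice path from $(0,0)$ to $(bn,an)$ with steps $U=(0,1)$, $R=(1,0)$, weakly above $y=ax/b$, identified with its word of length $N=(a+b)n$. Its step sequence $u_1<\dots<u_{an}$ is the list of positions of the letters $U$; $x(m)$ denotes the $x$-coordinate of the $m$-th up step, which goes from $(x(m),m-1)$ to $(x(m),m)$. Promotion: the toggle $t_i$ ($1\le i\le N-1$) exchanges the $i$-th and $(i+1)$-st letters if the result is an $(a,b)$-Dyck path, and otherwise fixes the path; $\partial=t_{N-1}\cdots t_2t_1$ ($t_1$ applied first). Rowmotion: consider the poset of unit boxes above the lowest $(a,b)$-Dyck path and below the top path $U^{an}R^{bn}$, where a box is larger the further up and/or to the left it is (covers: the box immediately above and the box immediately to the left). A path $p$ corresponds to the order filter $F(p)$ of boxes above $p$; $\delta(p)$ is the path whose filter is the complement of the order ideal generated by the minimal elements of $F(p)$. Perfect matching $\mathrm{PM}(p)=\{S_1,\dots,S_{an}\}$: a set partition of $[1,N]$ constructed as follows. Let $V$ be the set of positions of right steps. For $m=an,an-1,\dots,1$: draw the ray with slope $a/b$ from the point $(x(m),m-1)$ to the right, let $(s,t)$ be its first intersection with $p$ after the starting point, and $s'=\lfloor s\rfloor$. Put $S_m=\{u_m\}\cup(V\cap[x(m)+m+1,\,s'+t])$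 and replace $V$ by $V\setminus S_m$. The sequence $K(p)$: write $\bar i=N+1-i$ for $1\le i\le an$ (''barred integers''; as integers they fill $[bn+1,N]$). Number the rows $1,\dots,an$ from the top. Then $K(p)=(k_1,\dots,k_{an})$ with $k_i=bn-j+1$ if the up step in the $i$-th row is immediately preceded by a right step (a valley $RU$), that right step being in the $j$-th column from the left, and $k_i=\bar i$ otherwise. The path $p$ is determined by the set of entries of $K(p)$. Matching map: $\mathrm{Mat}$ is the bijection on $(a,b)$-Dyck paths of size $n$ whose inverse $\mathrm{Mat}^{-1}:q\mapsto p$ is: define $H(i)=i$ for $i\in[1,bn]$ and $H(\bar i)=\lceil bi/a\rceil$ for $1\le i\le an$. In each block of $\mathrm{PM}(q)$ (a subset of $[1,bn]\cup\{\bar i:1\le i\le an\}=[1,N]$) select the element with maximal $H$-value, choosing a barred element if an unbarred and a barred element tie. The $an$ selected elements form the set of entries of $K(p)$, and $p=\mathrm{Mat}^{-1}(q)$. *)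

(* Defs.v *)
From mathcomp Require Import all_boot all_order all_algebra.
From mathcomp Require Import zify.

Set Implicit Arguments.
Unset Strict Implicit.
Unset Printing Implicit Defensive.

Import Order.TTheory GRing.Theory Num.Theory.

Notation U := true (only parsing).
Notation R := false (only parsing).

(* Positions in a word are numbered from 1. *)
Definition letter (w : seq bool) (i : nat) : bool := nth R w i.-1.

(* The word w visits the points (rights w i, ups w i), 0 <= i <= size w. *)
Definition rights (w : seq bool) (i : nat) : nat := count_mem R (take i w).
Definition ups (w : seq bool) (i : nat) : nat := count_mem U (take i w).

(* A lattice path is weakly above a line of positive slope as soon as its
   lattice points are. *)
Definition is_dyck (a b n : nat) (w : seq bool) : bool :=
  [&& count_mem U w == a * n, count_mem R w == b * n &
      all (fun i => a * rights w i <= b * ups w i) (iota 0 (size w).+1)].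

Definition dyck (a b n : nat) : Type :=
  {w : ((a + b) * n).-tuple bool | is_dyck a b n w}.

Definition word a b n (p : dyck a b n) : seq bool := val (val p).

Definition up_positions (w : seq bool) : seq nat :=
  [seq i <- iota 1 (size w) | letter w i == U].
Definition right_positions (w : seq bool) : seq nat :=
  [seq i <- iota 1 (size w) | letter w i == R].

(* Up steps are numbered from 1. *)
Definition up_pos (w : seq bool) (m : nat) : nat := nth 0 (up_positions w) m.-1.
Definition xcoord (w : seq bool) (m : nat) : nat := up_pos w m - m.

Definition swap (N i : nat) (w : N.-tuple bool) : N.-tuple bool :=
  [tuple letter w (if k.+1 == i then i.+1 else if k.+1 == i.+1 then i else k.+1)
    | k < N].

Definition toggle a b n (p : dyck a b n) (i : nat) : dyck a b n :=
  insubd p (swap i (val p)).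

Definition promotion a b n (p : dyck a b n) : dyck a b n :=
  foldl (@toggle a b n) p (iota 1 ((a + b) * n).-1).

Lemma swapK N i (w : N.-tuple bool) : 0 < i < N -> swap i (swap i w) = w.
Proof.
move=> /andP[i0 iN].
have sE (v : N.-tuple bool) j : 0 < j <= N ->
    letter (swap i v) j = letter v (if j == i then i.+1 else if j == i.+1 then i else j).
  case: j => // j /andP[_ jN]; rewrite {1}/letter /=.
  by rewrite (_ : j = Ordinal jN) // -(tnth_nth R (swap i v) (Ordinal jN)) tnth_mktuple.
apply: eq_from_tnth => k; rewrite tnth_mktuple sE; last first.
  by have := ltn_ord k; do 2?case: eqP => ?; lia.
rewrite (tnth_nth R) /letter; congr (nth _ _ _).
by have := ltn_ord k; case: (k.+1 =P i) => ?; [rewrite eqxx; case: eqP|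
  case: (k.+1 =P i.+1) => ?; rewrite ?eqxx; repeat case: eqP => ? /=]; lia.
Qed.

Lemma toggleK a b n i (p : dyck a b n) :
  0 < i < (a + b) * n -> toggle (toggle p i) i = p.
Proof.
move=> iN; rewrite /toggle.
case: (boolP (is_dyck a b n (swap i (val p)))) => h.
  apply: val_inj; rewrite val_insubd.
  have -> : val (insubd p (swap i (val p))) = swap i (val p) by rewrite val_insubd h.
  by rewrite swapK // (valP p).
have -> : insubd p (swap i (val p)) = p.
  by apply: val_inj; rewrite val_insubd (negbTE h).
by apply: val_inj; rewrite val_insubd (negbTE h).
Qed.

Lemma promotion_inj a b n : injective (@promotion a b n).
Proof.
rewrite /promotion; set s := iota _ _.
have : all (fun i => 0 < i < (a + b) * n) s.
  by apply/allP => i; rewrite mem_iota; lia.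
elim: s => [|i s IH] /= => [_ p q //|/andP[hi hs] p q /(IH hs) e].
by rewrite -(toggleK p hi) e toggleK.
Qed.

Definition promotion_inv a b n : dyck a b n -> dyck a b n :=
  invF (@promotion_inj a b n).

(* The pair (i, j) stands for the unit box [i, i+1] x [j, j+1]. *)
Definition box (a b n : nat) : Type := ('I_(b * n) * 'I_(a * n))%type.

(* A box is above the lowest path iff it lies weakly above the line y = ax/b,
   that is, iff its lower right corner does. *)
Definition boxes (a b n : nat) : {set box a b n} :=
  [set B : box a b n | a * B.1.+1 <= b * B.2].

Definition box_le a b n (B C : box a b n) : bool :=
  (C.1 <= B.1) && (B.2 <= C.2).

(* The boxes above p in a given row are those to the left of its up step. *)
Definition filter_of a b n (p : dyck a b n) : {set box a b n} :=
  [set B : box a b n | B.1 < xcoord (word p) B.2.+1].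

Definition minimal_elements a b n (A : {set box a b n}) : {set box a b n} :=
  [set B in A | [forall C in A, box_le C B ==> (C == B)]].

Definition order_ideal a b n (A : {set box a b n}) : {set box a b n} :=
  [set B in boxes a b n | [exists C in A, box_le B C]].

Definition rowmotion_filter a b n (p : dyck a b n) : {set box a b n} :=
  boxes a b n :\: order_ideal (minimal_elements (filter_of p)).

(* The default value p is never used, see rowmotionP. *)
Definition rowmotion a b n (p : dyck a b n) : dyck a b n :=
  odflt p [pick q | filter_of q == rowmotion_filter p].

Lemma mem_up_positions w i :
  (i \in up_positions w) = [&& 0 < i, i <= size w & letter w i].
Proof. by rewrite mem_filter mem_iota eqb_id andbC -andbA. Qed.

Lemma up_positions_sorted w : sorted ltn (up_positions w).
Proof. exact: (sorted_filter ltn_trans _ (iota_ltn_sorted _ _)). Qed.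

Lemma count_mem_letter (w : seq bool) c :
  count_mem c w = size [seq i <- iota 1 (size w) | letter w i == c].
Proof.
rewrite size_filter -[in LHS](mkseq_nth R w) /mkseq count_map.
by rewrite -[1]/(1 + 0) iotaDl count_map; apply: eq_count.
Qed.

Lemma size_up_positions a b n (p : dyck a b n) :
  size (up_positions (word p)) = a * n.
Proof. by rewrite -count_mem_letter; case/and3P: (valP p) => /eqP. Qed.

Lemma up_pos_gt0 w m : 0 < m <= size (up_positions w) -> m <= up_pos w m.
Proof.
case: m => // m /= mw; rewrite /up_pos /=.
elim: m mw => [|m IH] mw.
  by have := mem_nth 0 mw; rewrite mem_up_positions => /andP[].
apply: leq_ltn_trans (IH (ltnW mw)) _.
by have /(sortedP 0) := up_positions_sorted w; apply.
Qed.

Lemma filter_of_inj a b n : injective (@filter_of a b n).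
Proof.
move=> p q pq; apply/val_inj/val_inj; rewrite -!/(word _).
have szN (r : dyck a b n) : size (word r) = (a + b) * n by rewrite size_tuple.
have upE : up_positions (word p) = up_positions (word q).
  apply: (@eq_from_nth _ 0) => [|j]; rewrite !size_up_positions // => jn.
  have xle (r : dyck a b n) : xcoord (word r) j.+1 <= b * n.
    rewrite /xcoord /up_pos /=; set u := nth _ _ _.
    have sz := size_up_positions r.
    have incr k : j + k < a * n -> u + k <= nth 0 (up_positions (word r)) (j + k).
      elim: k => [|k IH] jk; first by rewrite !addn0.
      rewrite !addnS; apply: leq_ltn_trans (IH _) _; first by lia.
      by have /(sortedP 0) := up_positions_sorted (word r); apply; rewrite sz; lia.
    have := incr (a * n - j.+1).
    have e : j + (a * n - j.+1) = (a * n).-1 by lia.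
    have an : (a * n).-1 < a * n by lia.
    rewrite e => /(_ an) h.
    have := mem_nth 0 (s := up_positions (word r)) (n := (a * n).-1).
    rewrite sz => /(_ an); rewrite mem_up_positions szN mulnDl => /and3P[_ + _].
    by move=> g; have := leq_trans h g; clear -jn; lia.
  have E : xcoord (word p) j.+1 = xcoord (word q) j.+1.
    apply/eqP; rewrite eqn_leq; apply/andP; split; rewrite leqNgt; apply/negP => lt.
      have ib : xcoord (word q) j.+1 < b * n by apply: leq_trans lt (xle p).
      have := congr1 (fun A : {set box a b n} => (Ordinal ib, Ordinal jn) \in A) pq.
      by rewrite !inE /= ltnn lt.
    have ib : xcoord (word p) j.+1 < b * n by apply: leq_trans lt (xle q).
    have := congr1 (fun A : {set box a b n} => (Ordinal ib, Ordinal jn) \in A) pq.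
    by rewrite !inE /= ltnn lt.
  have hp := @up_pos_gt0 (word p) j.+1; have hq := @up_pos_gt0 (word q) j.+1.
  by move: E hp hq; rewrite !size_up_positions /xcoord /up_pos /= => E /(_ jn) hp /(_ jn) hq; lia.
apply: (@eq_from_nth _ R) => [|k]; rewrite !szN // => kN.
have := congr1 (fun s : seq nat => k.+1 \in s) upE.
by rewrite !mem_up_positions !szN kN.
Qed.

Lemma ups_rights w i : i <= size w -> ups w i + rights w i = i.
Proof.
move=> iw; rewrite -[RHS](size_takel iw) -(count_predC (pred1 U) (take i w)).
by congr (_ + _); apply: eq_count => -[].
Qed.

Lemma filter_of_surj a b n (G : {set box a b n}) :
    G \subset boxes a b n ->
    (forall B C, B \in G -> C \in boxes a b n -> box_le B C -> C \in G) ->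
  exists p : dyck a b n, filter_of p = G.
Proof.
move=> /subsetP Gsub Gup.
pose X j := \max_(B in G | B.2 == j :> nat) B.1.+1.
have XP (i : 'I_(b * n)) (j : 'I_(a * n)) : (i < X j) = ((i, j) \in G).
  apply/idP/idP => [|ijG]; last first.
    by apply: (leq_bigmax_cond (F := fun B : box a b n => B.1.+1) (i, j)); rewrite ijG /=.
  rewrite ltnNge => /negP h; apply: contraT => ijG; case: h.
  apply/bigmax_leqP => -[i' j'] /= /andP[G' /eqP/val_inj ej]; subst j'.
  rewrite ltnNge; apply: contra ijG => ii'.
  have := Gsub _ G'; rewrite inE /= => bx.
  apply: (Gup _ _ G'); rewrite /box_le ?inE /= ?leqnn; last by lia.
  by apply: leq_trans bx; rewrite leq_mul2l; lia.
have Xb j : X j <= b * n by apply/bigmax_leqP => B _; exact: ltn_ord.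
have Xd j : a * X j <= b * j.
  rewrite /X; elim/big_ind: _ => [|x y|B /andP[/Gsub]].
  - by rewrite muln0.
  - by rewrite /maxn; case: ifP.
  by rewrite inE => h /eqP <-.
have Xmono j j' : j <= j' -> j' < a * n -> X j <= X j'.
  move=> jj' jn; apply/bigmax_leqP => -[i i'] /= /andP[ijG /eqP e].
  rewrite (XP i (Ordinal jn)); have := Gsub _ ijG; rewrite inE /= => bx.
  apply: (Gup _ _ ijG); rewrite ?inE /box_le /= ?leqnn ?e //.
  by apply: leq_trans bx _; rewrite leq_mul2l e jj' orbT.
pose N := (a + b) * n; pose f j := (X j + j).+1.
pose w := [tuple (k.+1 \in map f (iota 0 (a * n))) | k < N].
have szw : size w = N by rewrite size_tuple.
have fS j j' : j < j' -> j' < a * n -> f j < f j'.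
  by move=> jj' jn; have := Xmono j j' (ltnW jj') jn; rewrite /f; lia.
have upE : up_positions w = map f (iota 0 (a * n)).
  apply: (irr_sorted_eq ltn_trans ltnn (up_positions_sorted w)).
    apply/(sortedP 0) => i; rewrite size_map size_iota => ia.
    rewrite !(nth_map 0) ?size_iota //; try by lia.
    by rewrite !nth_iota; try lia; apply: fS; lia.
  move=> i; rewrite mem_up_positions szw.
  apply/and3P/idP => [[i0 iN]|iM].
    case: i i0 iN => // k _ kN; rewrite /letter /=.
    by rewrite -(tnth_nth R w (Ordinal kN)) tnth_mktuple.
  have [i0 iN] : 0 < i /\ i <= N.
    case/mapP: (iM) => j; rewrite mem_iota /f => jn ->.
    by have := Xb j; rewrite /N; split=> //; lia.
  split=> //; case: i i0 iN iM => // k _ kN; rewrite /letter /=.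
  by rewrite -(tnth_nth R w (Ordinal kN)) tnth_mktuple.
have cU : count_mem U w = a * n.
  by rewrite count_mem_letter -/(up_positions w) upE size_map size_iota.
have cR : count_mem R w = b * n.
  have := ups_rights (leqnn (size w)); rewrite /ups /rights take_size cU szw /N.
  by move=> e; apply: (@addnI (a * n)); rewrite -mulnDl.
have upsE i : i <= N -> ups w i = count (fun j => f j <= i) (iota 0 (a * n)).
  move=> iN; rewrite /ups count_mem_letter size_takel ?szw //.
  rewrite size_filter -(count_map f (fun v => v <= i)) -upE /up_positions.
  rewrite count_filter szw.
  have -> : iota 1 N = iota 1 i ++ iota (1 + i) (N - i) by rewrite -iotaD subnKC.
  rewrite count_cat [X in _ = _ + X](_ : _ = 0) ?addn0.
    apply: eq_in_count => k; rewrite mem_iota => kb.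
    rewrite /letter nth_take; last by lia.
    by rewrite /= (_ : (k <= i) = true) //; lia.
  apply/eqP; rewrite -leqn0 leqNgt -has_count; apply/hasPn => k.
  by rewrite mem_iota => kb; rewrite negb_and -ltnNge; apply/orP; left; lia.
have wD : is_dyck a b n w.
  rewrite /is_dyck cU cR !eqxx !andTb; apply/allP => i; rewrite mem_iota szw => iN.
  have {}iN : i <= N by lia.
  have e := ups_rights (w := w) (i := i); rewrite szw in e; have {}e := e iN.
  set y := ups w i in e *; set x := rights w i in e *.
  have [yn|yn] := ltnP y (a * n); last first.
    have xb : x <= b * n.
      by rewrite -cR /x /rights -{2}(cat_take_drop i w) count_cat leq_addr.
    have h1 : a * x <= a * (b * n) by rewrite leq_mul2l xb orbT.
    have h2 : b * (a * n) <= b * y by rewrite leq_mul2l yn orbT.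
    by apply: leq_trans h1 (leq_trans _ h2); rewrite !mulnA (mulnC a b).
  have fy : i < f y.
    rewrite ltnNge; apply/negP => fy.
    have : y.+1 <= y; last by rewrite ltnn.
    rewrite {2}/y upsE // -(subnKC yn) iotaD count_cat.
    apply: leq_trans (leq_addr _ _).
    rewrite (eq_in_count (a2 := predT)) ?count_predT ?size_iota //.
    move=> j; rewrite mem_iota /= add0n => jy.
    apply: leq_trans fy; case: (ltngtP j y) => [jl||->] //; last by lia.
    exact: ltnW (fS _ _ jl yn).
  have xX : x <= X y by move: fy; rewrite /f; lia.
  by apply: leq_trans (Xd y); rewrite leq_mul2l xX orbT.
exists (Sub w wD); apply/setP => -[i j]; rewrite inE /= -XP; congr (_ < _).
rewrite /xcoord /up_pos /word SubK upE (nth_map 0) ?size_iota //=.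
by rewrite nth_iota // /f add0n -addnS addnK.
Qed.

Lemma rowmotionP a b n (p : dyck a b n) :
  filter_of (rowmotion p) = rowmotion_filter p.
Proof.
rewrite /rowmotion; case: pickP => [q /eqP //|h].
have [||q hq] := @filter_of_surj a b n (rowmotion_filter p).
- exact: subsetDl.
- move=> B C; rewrite !in_setD => /andP[hB Bb] Cb BC; rewrite Cb andbT.
  apply: contra hB; rewrite !inE in Bb Cb *; rewrite Bb Cb /= => /exists_inP[M hM CM].
  apply/exists_inP; exists M => //.
  by move: BC CM; rewrite /box_le; lia.
by have := h q; rewrite hq eqxx.
Qed.

(* The point where the ray with slope a/b starting at (x(m), m-1) meets the
   (k+1)-st step of w, if it does so after its starting point. *)
Definition ray_hit (a b : nat) (w : seq bool) (m k : nat) : option (rat * rat) :=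
  (let x0 := (xcoord w m)%:R in let y0 := m.-1%:R in
   let x := (rights w k)%:R in let y := (ups w k)%:R in
   if letter w k.+1 == U then
     let t := y0 + a%:R / b%:R * (x - x0) in
     if (x0 < x) && (y <= t <= y + 1) then Some (x, t) else None
   else
     let s := x0 + b%:R / a%:R * (y - y0) in
     if (x0 < s) && (x <= s <= x + 1) then Some (s, y) else None)%R.

(* Both the ray and the path are weakly increasing in each coordinate, so the
   first intersection along the ray is the first one along the path. There is
   one, as the ray starts weakly above y = ax/b and p ends on that line; the
   default value is never used. *)
Definition first_hit (a b : nat) (w : seq bool) (m : nat) : rat * rat :=
  head (0, 0)%R (pmap (ray_hit a b w m) (iota 0 (size w))).

(* S_m, where V lists the positions of the right steps still available. *)
Definition block (a b : nat) (w : seq bool) (V : seq nat) (m : nat) : seq nat :=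
  let: (s, t) := first_hit a b w m in
  up_pos w m :: [seq v <- V | (xcoord w m + m + 1 <= v)
                              && (v%:R <= (Num.floor s)%:~R + t)%R].

Fixpoint blocks (a b : nat) (w : seq bool) (V : seq nat) (m : nat) : seq (seq nat) :=
  if m is m'.+1 then
    let B := block a b w V m in
    B :: blocks a b w [seq v <- V | v \notin B] m'
  else [::].

Definition perfect_matching a b n (p : dyck a b n) : seq (seq nat) :=
  blocks a b (word p) (right_positions (word p)) (a * n).

Definition bar (a b n i : nat) : nat := (a + b) * n + 1 - i.

Definition barred (b n v : nat) : bool := b * n < v.

(* The i-th row from the top contains the up step number an + 1 - i; a right
   step preceding the up step number m lies in column x(m). *)
Definition K_entry a b n (p : dyck a b n) (i : nat) : nat :=
  let w := word p in let m := a * n + 1 - i in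
  if (1 < up_pos w m) && (letter w (up_pos w m).-1 == R)
  then b * n - xcoord w m + 1 else bar a b n i.

Definition K_seq a b n (p : dyck a b n) : seq nat :=
  [seq K_entry p i | i <- iota 1 (a * n)].

(* Note that v = bar i iff i = bar v, for v in [1, N]. *)
Definition H_value (a b n v : nat) : int :=
  if barred b n v then Num.ceil ((b * bar a b n v)%:R / a%:R : rat)%R
  else Posz v.

(* Maximal H-value, ties being won by barred elements; two barred elements of
   one block of a perfect matching never tie. *)
Definition is_selected (a b n : nat) (B : seq nat) (v : nat) : bool :=
  all (fun v' => (H_value a b n v' < H_value a b n v)%R
         || (H_value a b n v' == H_value a b n v)
            && (barred b n v' ==> barred b n v)) B.

Definition selected a b n (q : dyck a b n) : seq nat :=
  flatten [seq [seq v <- B | is_selected a b n B v] | B <- perfect_matching q].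

(* The sequences K_seq and selected are compared as sets of entries. *)
Definition matching_map a b n (Mat : dyck a b n -> dyck a b n) : Prop :=
  exists Matinv : dyck a b n -> dyck a b n,
    [/\ cancel Mat Matinv, cancel Matinv Mat
      & forall q, K_seq (Matinv q) =i selected q].

(* Main.v *)
Require Import Defs.
From mathcomp Require Import all_boot all_order all_algebra.
From mathcomp Require Import zify ring lra.
Import Order.TTheory GRing.Theory Num.Theory.

(** Write [N = (a + b) n], and let the height of a walk after [i] steps be
    [b * ups - a * rights]. A Dyck path is a walk that stays at nonnegative
    heights and ends at height 0.

    _Promotion_ ([letter_promotion]) deletes the initial up step, turns into an
    up step the right step where the line first stops the shortened walk, and
    appends a right step: [U A R B] becomes [A U B R].

    _Arcs._ By the height picture of the rays ([ray_owner]), a right step lies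
    in the block of the last earlier up step that starts weakly below its end.
    Call the pairs of consecutive elements of the blocks arcs. Promotion need
    not rotate the perfect matching, because the appended step may join a block
    other than that of the new up step, but it rotates the arcs
    ([arc_promotion]): the arc at position 1 disappears, all others move one
    place to the left, and an arc ending at [N] is created. Hence the number
    of arcs inside a window of positions [k < i <= r] of a path [q] is the number
    of right steps among the first [r - k] letters of the [k]-th iterate of
    promotion at [q] ([arcs_iter]).

    _Selection._ Whether the opener [x] of an arc beats its closer [y] in the
    order by maximal H-value is the linear inequality
    [b * (N + 1 - y) <= a * (x - 1)], and along a block these comparisons are
    monotone, so that the selected element of a block is the one that loses on
    neither side ([mem_selected]). A path [p] is determined by the counts of
    entries of [K(p)] in initial sets of columns and rows: a box lies above [p]
    iff one difference of these counts is positive ([K_filter]), and the order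
    ideal that defines rowmotion is described by the sign of another one
    ([K_ideal]). For the set of selected elements, a double count of the arcs
    ([unbeaten_count]) shows that both signs compare the number of arcs in a
    window with the number of remaining columns. An arc whose opener beats its
    closer would disturb the count, but it is so long that it already forces
    the sign ([outranking_arcs_gt0]).

    _Conclusion._ The window of a box [B] in column [k] from the right has enough
    arcs iff [B] lies above the [k]-th iterate of promotion at [q]. So the path
    obtained by taking, for every [k], the [k]-th column from the right of the
    [k]-th iterate of promotion at [q] has the selected elements of [q] as its
    entries: it is the inverse matching map applied to [q]. Promoting [q] moves
    every window one place, which is the difference between the two signs, that
    is, one step of rowmotion ([rowmotion_matching_inv]). As the columns of [q]
    can be read off from the rowmotion orbit of its image, the inverse matching
    map is injective, hence bijective. *)

Set Implicit Arguments.
Unset Strict Implicit.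
Unset Printing Implicit Defensive.

(** * Words, heights and up steps *)

Lemma upsS w i : i < size w -> ups w i.+1 = ups w i + letter w i.+1.
Proof.
move=> iw; rewrite /ups (take_nth false iw) -cats1 count_cat /= addn0 /letter /=.
by case: nth.
Qed.

Lemma rightsS w i : i < size w -> rights w i.+1 = rights w i + ~~ letter w i.+1.
Proof.
move=> iw; rewrite /rights (take_nth false iw) -cats1 count_cat /= addn0 /letter /=.
by case: nth.
Qed.

Lemma leq_ups w i j : i <= j -> ups w i <= ups w j.
Proof.
move=> ij; rewrite /ups -(cat_take_drop i (take j w)) count_cat.
by rewrite (take_takel _ ij) leq_addr.
Qed.

Lemma leq_rights w i j : i <= j -> rights w i <= rights w j.
Proof.
move=> ij; rewrite /rights -(cat_take_drop i (take j w)) count_cat.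
by rewrite (take_takel _ ij) leq_addr.
Qed.

Lemma up_pos_ups w u :
  0 < u <= size w -> letter w u -> up_pos w (ups w u) = u.
Proof.
case: u => // u /= uw lu; rewrite upsS // lu addn1 /up_pos /up_positions /=.
have -> : size w = u + (size w - u.+1).+1 by lia.
rewrite iotaD filter_cat /= add1n lu /= nth_cat.
have -> : size [seq i <- iota 1 u | letter w i == true] = ups w u.
  rewrite /ups count_mem_letter size_takel 1?ltnW //; congr size.
  apply: eq_in_filter => i; rewrite mem_iota => iu.
  by rewrite /letter nth_take //; lia.
by rewrite ltnn subnn.
Qed.

Lemma mem_up_pos w m :
  0 < m <= size (up_positions w) -> up_pos w m \in up_positions w.
Proof. by case: m => // m mw; apply: mem_nth. Qed.

Lemma ups_up_pos w m :
  0 < m <= size (up_positions w) -> ups w (up_pos w m) = m.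
Proof.
move=> mw; have := mem_up_pos mw; rewrite mem_up_positions => /and3P[u0 uw lu].
have e := up_pos_ups (introT andP (conj u0 uw)) lu.
have k0 : 0 < ups w (up_pos w m).
  by case: (up_pos w m) u0 uw lu {e} => // u _ uw lu; rewrite upsS // lu addn1.
have kw : ups w (up_pos w m) <= size (up_positions w).
  by have := leq_ups w uw; rewrite {2}/ups take_size count_mem_letter.
have := sorted_uniq ltn_trans ltnn (up_positions_sorted w).
move=> /uniqP /(_ (ups w (up_pos w m)).-1 m.-1) h.
have /(_ _ _ e) := h 0; rewrite !inE !prednK //; last by case/andP: mw.
by case/andP: mw => m0 mw /(_ kw mw); lia.
Qed.

Lemma ltn_up_pos w m i :
  0 < m <= size (up_positions w) -> (i < up_pos w m) = (ups w i < m).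
Proof.
move=> mw; have := mem_up_pos mw; rewrite mem_up_positions => /and3P[u0 uw lu].
have := ups_up_pos mw; case: (up_pos w m) u0 uw lu => // u _ uw lu.
rewrite upsS // lu addn1 => <-.
have [iu|ui] := ltnP; first by rewrite ltnS leq_ups.
by have := leq_ups w ui; rewrite upsS // lu; lia.
Qed.

(** For a point (x, y) of a path this is [b * y - a * x], which is constant along
    the rays. On Dyck paths the truncated subtraction is exact. *)
Definition height (a b : nat) (w : seq bool) (i : nat) : nat :=
  b * ups w i - a * rights w i.

Section Dyck.
Variables (a b n : nat).
Hypotheses (a_gt0 : 0 < a) (b_gt0 : 0 < b) (n_gt0 : 0 < n).
Implicit Types (p q : dyck a b n).
Local Notation N := ((a + b) * n).
Local Notation height := (height a b).

Lemma size_word q : size (word q) = N.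
Proof. by rewrite size_tuple. Qed.

Lemma dyck_above q i : i <= N -> a * rights (word q) i <= b * ups (word q) i.
Proof.
move=> iN; case/and3P: (valP q) => _ _ /allP /(_ i); apply.
by rewrite mem_iota size_tuple; lia.
Qed.

Lemma height_up q i : i < N -> letter (word q) i.+1 ->
  height (word q) i.+1 = height (word q) i + b.
Proof.
move=> iN l; rewrite /height upsS ?rightsS ?size_word // l.
by have := dyck_above q (ltnW iN); rewrite !mulnDr; lia.
Qed.

Lemma height_right q i : i < N -> ~~ letter (word q) i.+1 ->
  height (word q) i = height (word q) i.+1 + a.
Proof.
move=> iN l; have := dyck_above q iN.
by rewrite /height upsS ?rightsS ?size_word // (negbTE l) !mulnDr; lia.
Qed.

Lemma height0 w : height w 0 = 0.
Proof. by rewrite /height /ups take0 muln0. Qed.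

Lemma heightN q : height (word q) N = 0.
Proof.
rewrite /height /ups /rights -(size_word q) take_size.
by case/and3P: (valP q) => /eqP -> /eqP -> _; rewrite !mulnA (mulnC b a) subnn.
Qed.

Lemma rights_height q i : i <= N ->
  (a + b) * rights (word q) i + height (word q) i = b * i.
Proof.
move=> iN; have := dyck_above q iN.
have := @ups_rights (word q) i; rewrite size_word => /(_ iN) e.
by rewrite /height -[in RHS]e mulnDr mulnDl; lia.
Qed.

Lemma letter1 q : letter (word q) 1.
Proof.
apply: contraT => /height_right; rewrite height0 => /(_ _)/eqP.
by rewrite eq_sym addn_eq0 [a == 0]eqn0Ngt a_gt0 andbF; apply; lia.
Qed.

Lemma letterN q : ~~ letter (word q) N.
Proof.
have N0 : N.-1.+1 = N by lia.
apply/negP => l; have := @height_up q N.-1; rewrite N0 heightN => /(_ (leqnn _) l).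
by lia.
Qed.

(** Only up steps gain height, so that one of them crosses the level [H]. *)
Lemma up_crossing q i j H : i <= j <= N ->
  height (word q) i <= H < height (word q) j ->
  exists u, [/\ i < u <= j, letter (word q) u & height (word q) u.-1 <= H].
Proof.
elim: j => [|j IH] /andP[ij jN] /andP[hi hj]; first by have := height0 (word q); lia.
have {}ij : i <= j by case: ltngtP ij hi => // -> hi; lia.
have [l|l] := boolP (letter (word q) j.+1).
  have [hl|hl] := leqP (height (word q) j) H; first by exists j.+1; split=> //; lia.
  by case: IH => [||u [ui lu hu]]; try lia; exists u; split=> //; lia.
have := height_right jN l => e.
by case: IH => [||u [ui lu hu]]; try lia; exists u; split=> //; lia.
Qed.

(** * Promotion as a rewriting of words *)

Lemma letter_swap (v : N.-tuple bool) i j : 0 < j <= N ->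
  letter (swap i v) j =
  letter v (if j == i then i.+1 else if j == i.+1 then i else j).
Proof.
case: j => // j /andP[_ jN]; rewrite {1}/letter /=.
by rewrite (_ : j = Ordinal jN) // -(tnth_nth false (swap i v) (Ordinal jN)) tnth_mktuple.
Qed.

Lemma rights_swap (v : N.-tuple bool) i j : 0 < i < N -> j <= N ->
  rights (swap i v) j =
  if j == i then rights v i.-1 + ~~ letter v i.+1 else rights v j.
Proof.
move=> iN; elim: j => [|j IH] jN; first by rewrite /rights !take0; case: eqP; lia.
rewrite rightsS ?size_tuple // letter_swap // (IH (ltnW jN)).
case: (j.+1 =P i) => [<-|ni]; first by rewrite ltn_eqF.
rewrite eqSS; case: (j =P i) => [->|nj]; last by rewrite rightsS // size_tuple.
rewrite [in RHS]rightsS ?size_tuple; last by lia.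
case: i iN {IH ni} => // i iN; rewrite [in RHS]rightsS ?size_tuple /=; lia.
Qed.

Lemma is_dyckE (v : N.-tuple bool) :
  is_dyck a b n v =
  (rights v N == b * n) && all (fun i => (a + b) * rights v i <= b * i) (iota 0 N.+1).
Proof.
have sz : size v = N by rewrite size_tuple.
have e := @ups_rights v N; rewrite sz leqnn in e; have {}e := e isT.
rewrite /is_dyck sz; have -> : count_mem false v = rights v N.
  by rewrite /rights -{2}sz take_size.
have -> : count_mem true v = ups v N by rewrite /ups -{2}sz take_size.
rewrite andbA.
have -> : (ups v N == a * n) && (rights v N == b * n) = (rights v N == b * n).
  by case: (rights v N =P b * n); lia.
congr (_ && _); apply: eq_in_all => i; rewrite mem_iota => iN.
have := @ups_rights v i; rewrite sz => /(_ ltac:(lia)) ei.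
have -> : b * i = b * ups v i + b * rights v i by rewrite -mulnDr ei.
by rewrite (mulnDl a b (rights v i)); lia.
Qed.

Lemma word_toggle p i : 0 < i < N ->
  word (toggle p i) =
  if [&& letter (word p) i, ~~ letter (word p) i.+1 & height (word p) i.-1 < a]
  then word p else swap i (val p).
Proof.
case: i => // i iN; suff dy : is_dyck a b n (swap i.+1 (val p)) =
    ~~ [&& letter (word p) i.+1, ~~ letter (word p) i.+2 & height (word p) i < a].
  by rewrite /word /toggle val_insubd dy if_neg; case: ifP.
(* Only the prefix of length i.+1 changes its number of right steps. *)
have := valP p; rewrite is_dyckE => /andP[/eqP rN /allP rp].
rewrite is_dyckE !rights_swap // [N == _]gtn_eqF ?rN ?eqxx ?andTb; last by lia.
have e : (a + b) * rights (word p) i + height (word p) i = b * i.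
  by apply: rights_height; lia.
have ei : b * i.+1 = b * i + b by rewrite mulnSr.
have h : letter (word p) i.+1 = false -> a <= height (word p) i.
  by move=> l; rewrite height_right ?l ?leq_addl //; lia.
apply/allP/idP => [/(_ i.+1)|ok j].
  rewrite mem_iota rights_swap ?eqxx; try lia.
  move=> /(_ ltac:(lia)); rewrite mulnDr -/(word p) ei /=.
  case: (letter (word p) i.+2); rewrite /= ?andbF ?andbT ?muln1 // => g.
  rewrite negb_and -leqNgt; apply/orP; right; lia.
rewrite mem_iota => jN; rewrite rights_swap //.
case: (j =P i.+1) => [->|_]; last by apply: rp; rewrite mem_iota.
rewrite mulnDr -/(word p) ei /=.
case: (letter (word p) i.+2) ok; rewrite ?andbF ?andbT /= => ok; first by lia.
by case: (letter (word p) i.+1) ok h => /= ok h; [|have := h erefl]; lia.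
Qed.

(** Deleting the initial up step lowers the walk by [b], so that this is the
    first step that would then end below the line. *)
Definition descent q : nat :=
  find (fun i => (0 < i) && (height (word q) i < b)) (iota 0 N.+1).

Lemma descentP q :
  [/\ 1 < descent q <= N, ~~ letter (word q) (descent q),
      height (word q) (descent q) < b
    & forall i, 0 < i < descent q -> b <= height (word q) i].
Proof.
pose P i := (0 < i) && (height (word q) i < b).
have hP : has P (iota 0 N.+1).
  by apply/hasP; exists N; rewrite ?mem_iota /P ?heightN //; lia.
have dN : descent q < N.+1 by rewrite -[X in _ < X](size_iota 0 N.+1) -has_find.
have /andP[d0 lb] : P (descent q) by have := nth_find 0 hP; rewrite nth_iota.
have ge i : 0 < i < descent q -> b <= height (word q) i.
  case/andP=> i0 id; have := @before_find _ 0 P (iota 0 N.+1) i id.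
  by rewrite nth_iota ?(ltn_trans id) // /P i0 => /negbT; rewrite -leqNgt.
have l1 : 1 < descent q.
  rewrite ltnNge; apply: contraL lb => l1.
  have -> : descent q = 1 by apply/eqP; rewrite eqn_leq l1.
  by rewrite -leqNgt height_up ?letter1 ?height0 //; lia.
split=> //; first by rewrite l1.
apply: contraL lb => l; rewrite -leqNgt -(prednK d0) height_up ?prednK //.
by rewrite leq_addl.
Qed.

(** The toggles carry the initial up step to the right until the line stops
    it, and from there on they carry the right step that it met. *)
Lemma letter_partial_promotion q i j : i < N -> 0 < j <= N ->
  letter (word (foldl (@toggle a b n) q (iota 1 i))) j =
  if j <= i then (j == (descent q).-1) || letter (word q) j.+1
  else if j == i.+1 then i.+1 < descent q else letter (word q) j.
Proof.
move: (descent q) (descentP q) => l [/andP[l1 lN] ll lb lge].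
elim: i j => [|i IH] j iN jN.
  rewrite leqNgt; case/andP: jN => -> _ /=.
  by case: eqP => [->|_] //; rewrite l1 letter1.
have -> : iota 1 i.+1 = iota 1 i ++ [:: i.+1] by rewrite -{1}(addn1 i) iotaD add1n.
rewrite foldl_cat /=; set p := foldl _ _ _ in IH *.
have {}IH := fun j => IH j (ltnW iN).
have lp1 : letter (word p) i.+1 = (i.+1 < l) by rewrite IH ?ltnn ?eqxx //; lia.
have lp2 : letter (word p) i.+2 = letter (word q) i.+2.
  by rewrite IH; try lia; rewrite ltnNge leqnSn eqSS /= gtn_eqF.
have rp k : k <= i -> i.+1 < l -> rights (word p) k = rights (word q) k.+1.
  elim: k => [|k IHk] ki il.
    have -> : rights (word q) 1 = rights (word q) 0 + ~~ letter (word q) 1.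
      by apply: rightsS; rewrite size_word; lia.
    by rewrite letter1 /rights !take0.
  rewrite rightsS ?size_word ?(IHk (ltnW ki) il); last by lia.
  rewrite [in RHS]rightsS ?size_word ?IH ?ki; lia.
have hp : i.+1 < l -> height (word p) i + b = height (word q) i.+1.
  move=> il; have := @rights_height p i; have := @rights_height q i.+1.
  by rewrite rp // mulnSr => /(_ (ltnW iN)) e /(_ (ltnW (ltnW iN))); lia.
rewrite word_toggle ?lp1 ?lp2 //=.
case: ifP => [/and3P[il nl hi]|c].
  have el : l = i.+2.
    have := @height_right q i.+1 iN nl; rewrite -hp // => e.
    have : height (word q) i.+2 < b by lia.
    by case: (ltngtP l i.+2) => // [|h]; [lia|have := lge i.+2; lia].
  rewrite IH // el; have [ji|ji|->] := ltngtP j i.+1.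
  - by rewrite (_ : j <= i).
  - have [->|ni] := j =P i.+2; first by rewrite ltnNge leqnSn ltnn (negbTE nl).
    by rewrite (_ : (j <= i) = false) //; apply/negbTE; lia.
  - by rewrite ltnn /= ltnSn.
have nl : l != i.+2.
  apply/eqP => el; move: c; rewrite -el (negbTE ll) el ltnSn /= => /negbT.
  have := @height_right q i.+1 iN; rewrite -el ll => /(_ isT) e.
  by rewrite -leqNgt; have := hp; rewrite e; lia.
rewrite letter_swap // -/(word p). have [ji|ji|->] := ltngtP j i.+1.
- by rewrite (ltn_eqF (leqW ji)) IH // (_ : j <= i).
- have [_|ni] := j =P i.+2; first by rewrite lp1; lia.
  by rewrite IH // leqNgt (ltnW ji) (gtn_eqF ji).
- by rewrite lp2 (_ : (_ == _) = false) //; apply/negbTE; lia.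
Qed.

(** Past its end a word reads as right steps, which accounts for the last letter. *)
Lemma letter_promotion q j : 0 < j ->
  letter (word (promotion q)) j = (j == (descent q).-1) || letter (word q) j.+1.
Proof.
move=> j0; have [/andP[l1 lN] _ _ _] := descentP q.
have out p i : N < i -> letter (word p) i = false.
  by move=> Ni; rewrite /letter nth_default // size_word; lia.
have [jN|jN] := ltnP N j.
  by rewrite !out ?orbF ?gtn_eqF //; lia.
rewrite letter_partial_promotion; try lia.
have [h|h] := leqP j N.-1; first by [].
have -> : j = N by lia.
rewrite prednK ?eqxx; last by lia.
by rewrite out ?ltnSn // orbF; apply/idP/idP; lia.
Qed.

Lemma height_promotion q j : j < N ->
  if j < (descent q).-1 then height (word (promotion q)) j + b = height (word q) j.+1
  else height (word (promotion q)) j = height (word q) j.+1 + a.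
Proof.
have [/andP[l1 lN] ll _ _] := descentP q.
elim: j => [|j IH] jN.
  rewrite height0 (@height_up q 0) ?height0 ?letter1 //.
  by rewrite (_ : 0 < _) //; lia.
have {}IH := IH (ltnW jN).
have := letter_promotion q (ltn0Sn j); have [el|nl] := j.+1 =P (descent q).-1.
  rewrite orTb => lp; have el' : descent q = j.+2 by lia.
  rewrite el' in ll; rewrite -el ltnSn in IH.
  by rewrite -el ltnn height_up ?(ltnW jN) // IH; apply: height_right.
have -> : (j.+1 < (descent q).-1) = (j < (descent q).-1) by lia.
have [l|l] := boolP (letter (word q) j.+2); rewrite orFb => lp.
  have e := height_up jN l; have e' := height_up (ltnW jN) lp.
  by rewrite e e'; case: ifP IH; lia.
have e := height_right jN l.
have e' : height (word (promotion q)) j = height (word (promotion q)) j.+1 + a.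
  by apply: height_right; rewrite ?(ltnW jN) // lp.
by case: ifP IH; lia.
Qed.

(** * Blocks *)

(** Rays run along constant height. So a right step belongs to the up step seen
    when looking left along the walk, just above the height where the right step
    ends. This describes the blocks of the perfect matching without recursion,
    see [mem_blocks]. *)
Definition owner (w : seq bool) (v : nat) : nat :=
  if letter w v then v
  else \max_(u < v | letter w u && (height w u.-1 <= height w v)) u.

Lemma ownerP q v : 0 < v <= N -> ~~ letter (word q) v ->
  [/\ 0 < owner (word q) v < v, letter (word q) (owner (word q) v),
      height (word q) (owner (word q) v).-1 <= height (word q) v
    & forall u, owner (word q) v < u < v -> letter (word q) u ->
        height (word q) v < height (word q) u.-1].
Proof.
move=> /andP[v0 vN] nl; rewrite /owner (negbTE nl).
have v1 : 1 < v.
  by rewrite ltn_neqAle v0 andbT; apply: contraNneq nl => <-; apply: letter1.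
pose P (u : 'I_v) := letter (word q) u && (height (word q) u.-1 <= height (word q) v).
have P1 : P (Ordinal v1) by rewrite /P letter1 height0.
rewrite (bigop.bigmax_eq_arg _ P1); case: arg_maxnP => //= u /andP[lu hu] mx.
have u0 : 0 < u by apply: leq_trans (mx _ P1).
split=> // [|u' /andP[uu' u'v] lu']; first by rewrite u0 ltn_ord.
rewrite ltnNge; apply: contraL uu' => hu'; rewrite -leqNgt.
by apply: (mx (Ordinal u'v)); rewrite /P lu'.
Qed.

Lemma owner_up w v : letter w v -> owner w v = v.
Proof. by rewrite /owner => ->. Qed.

Lemma owner_eq q u v : 0 < v <= N -> ~~ letter (word q) v ->
    0 < u < v -> letter (word q) u -> height (word q) u.-1 <= height (word q) v ->
    (forall u', u < u' < v -> letter (word q) u' ->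
      height (word q) v < height (word q) u'.-1) ->
  owner (word q) v = u.
Proof.
move=> vN nl /andP[u0 uv] lu hu gt; have [/andP[o0 ov] lo ho gt'] := ownerP vN nl.
apply/eqP; rewrite eqn_leq; apply/andP; split; rewrite leqNgt; apply/negP => lt.
  by have := gt _ _ lo; rewrite lt ov ltnNge ho => /(_ isT).
by have := gt' _ _ lu; rewrite lt uv ltnNge hu => /(_ isT).
Qed.

Lemma owner_bounds q v : 0 < v <= N ->
  [/\ 0 < owner (word q) v <= v, letter (word q) (owner (word q) v)
    & height (word q) (owner (word q) v).-1 <= height (word q) v].
Proof.
move=> vN; have [l|nl] := boolP (letter (word q) v).
  rewrite owner_up // leqnn andbT; split=> //; first by case/andP: vN.
  by case: v vN l => // v vN l; rewrite height_up // leq_addr.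
by have [/andP[-> /ltnW ->] -> -> _] := ownerP vN nl.
Qed.

(** Between the up step of a block and one of its right steps, the walk has no
    up step that crosses the level of the end of this right step. *)
Lemma block_height_right q v : 0 < v <= N -> ~~ letter (word q) v ->
  height (word q) v < height (word q) (owner (word q) v).-1 + b.
Proof.
move=> vN nl; have [/andP[o0 ov] lo ho gt] := ownerP vN nl.
rewrite ltnNge; apply/negP => ge.
have ho' : height (word q) (owner (word q) v) = height (word q) (owner (word q) v).-1 + b.
  by rewrite -{1}(prednK o0) height_up ?prednK //; lia.
case: v vN nl ov ho ho' ge gt lo {o0} => // v vN nl.
set o := owner _ _ => ov ho ho' ge gt lo.
have e := height_right vN nl.
have [|| u [ou lu hu]] := @up_crossing q o v (height (word q) v.+1); try lia.
by have := gt u ltac:(lia) lu; rewrite ltnNge hu.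
Qed.

Lemma block_height q v : 0 < v <= N ->
  height (word q) v <= height (word q) (owner (word q) v).-1 + b.
Proof.
move=> vN; have [l|nl] := boolP (letter (word q) v).
  by rewrite owner_up //; case: v vN l => // v vN l; rewrite height_up.
exact: ltnW (block_height_right vN nl).
Qed.

(** The walk stays in a band of height [b] during a block, while a right step
    goes down by [a]. *)
Lemma block_gap q v v' : 0 < v -> v < v' -> v' <= N ->
  owner (word q) v = owner (word q) v' -> a <= b * (v' - v).
Proof.
move=> v0 vv' v'N ow.
have nl : ~~ letter (word q) v'.
  apply/negP => l; move: ow; rewrite (owner_up l) => ow.
  by have [] := @owner_bounds q v; rewrite ?ow; lia.
have [_ _ h1] := @owner_bounds q v' ltac:(lia).
have h2 := @block_height q v ltac:(lia); rewrite -ow in h1.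
have r : rights (word q) v < rights (word q) v'.
  case: v' vv' v'N nl {ow h1} => // v' vv' v'N nl.
  by rewrite (@rightsS _ v') ?size_word // nl addn1 ltnS leq_rights.
have e1 := @rights_height q v ltac:(lia); have e2 := @rights_height q v' v'N.
have : (a + b) * (rights (word q) v).+1 <= (a + b) * rights (word q) v'.
  by rewrite leq_mul2l r orbT.
by rewrite mulnBr mulnS; lia.
Qed.

(** Promotion shifts the blocks of all steps but the first one: before the
    descent the walk goes down by [b] as a whole, and after it up by [a] as a
    whole. The up steps between the first step and the descent start at height
    at least [b], so that they are hidden from the steps after the descent, and
    the new up step takes over what remains of the block of the deleted one. *)
Lemma owner_promotion q x : 0 < x < N ->
  owner (word (promotion q)) x =
  if owner (word q) x.+1 == 1 then (descent q).-1 else (owner (word q) x.+1).-1.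
Proof.
move=> /andP[x0 xN]; have [/andP[l1 lN] ll lb lge] := descentP q.
have lp j := @letter_promotion q j; have hp j := @height_promotion q j.
move: (descent q) l1 lN ll lb lge lp hp => l l1 lN ll lb lge lp hp.
have [lx|nlx] := boolP (letter (word (promotion q)) x).
  rewrite owner_up //; move: (lp x x0); rewrite lx => /esym/orP[/eqP xl|lx'].
    have xl' : x.+1 = l by lia.
    rewrite (@owner_eq q 1) ?eqxx ?letter1 ?xl' //; try lia.
      by rewrite height0.
    by move=> u ul lu; apply: leq_trans lb (lge _ _); lia.
  by rewrite owner_up //; case: x x0 {xN lx lx'} => // x _.
move: (lp x x0); rewrite (negbTE nlx) => /esym/norP[/eqP xl nlx'].
have x1N : 0 < x.+1 <= N by lia.
have [/andP[o0 ox] lo ho gt] := ownerP x1N nlx'.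
set o := owner (word q) x.+1 in o0 ox lo ho gt *.
have lpo : o != 1 -> letter (word (promotion q)) o.-1.
  by move=> o1; rewrite lp ?prednK ?lo ?orbT //; lia.
have [xl'|xl'] := ltnP x.+1 l.
  (* If a right step comes before the descent, the second step of the path is an up
     step. It starts at height b and hides the first step. *)
  have o1 : o != 1.
    have e1 : height (word q) 1 = b by rewrite height_up ?height0 ?letter1 //; lia.
    apply/eqP => o1; have l2 : letter (word q) 2.
      apply: contraT => nl2; have e := @height_right q 1 ltac:(lia) nl2.
      by have := lge 2 ltac:(lia); lia.
    have x1 : 2 < x.+1 by case: (ltngtP 2 x.+1) => // [|e]; [lia | rewrite -e l2 in nlx'].
    have := gt 2 ltac:(lia) l2; rewrite /= e1.
    by have := lge x.+1; lia.
  rewrite (negbTE o1); have lpo' := lpo o1; apply: owner_eq => //; try lia.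
    have := hp x ltac:(lia); have := hp o.-2 ltac:(lia).
    by rewrite !ifT; try lia; rewrite prednK; lia.
  case=> // u ou lu; have := gt u.+2 ltac:(lia).
  move: lu; rewrite lp // => /orP[|lu /(_ lu)]; first by lia.
  by have := hp x ltac:(lia); have := hp u ltac:(lia); rewrite !ifT /=; lia.
have {}xl' : l < x.+1 by lia.
have no : o != l by apply: contraTneq lo => ->.
have hx := hp x ltac:(lia); rewrite ifF in hx; last by lia.
have hx' := @height_right q x xN nlx'.
have [ol|ol] := leqP o l.
  (* An up step between the first one and the descent starts at height at least b,
     while the descent ends below b: a later up step hides it. *)
  have -> : o == 1.
    apply: contraT => o1; have ho1 : b <= height (word q) o.-1 by apply: lge; lia.
    have [|| u [lu' lu hu]] := @up_crossing q l x (height (word q) x.+1); try lia.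
    by have := gt u ltac:(lia) lu; rewrite ltnNge hu.
  apply: owner_eq => //; try lia.
  - by rewrite lp ?eqxx; lia.
  - have := hp l.-2 ltac:(lia); rewrite ifT; last by lia.
    rewrite prednK; last by lia.
    have := @height_right q l.-1 ltac:(lia); rewrite prednK; last by lia.
    by move=> /(_ ll); lia.
  case=> // u ou lu; have := gt u.+2 ltac:(lia).
  move: lu; rewrite lp // => /orP[|lu /(_ lu)]; first by lia.
  by have := hp u ltac:(lia); rewrite ifF /=; lia.
have o1 : o != 1 by lia.
rewrite (negbTE o1); have lpo' := lpo o1; apply: owner_eq => //; try lia.
  have := hp o.-2 ltac:(lia); rewrite ifF; last by lia.
  by rewrite prednK; lia.
case=> // u ou lu; have := gt u.+2 ltac:(lia).
move: lu; rewrite lp // => /orP[|lu /(_ lu)]; first by lia.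
by have := hp u ltac:(lia); rewrite ifF /=; lia.
Qed.

(** * Arcs *)

Definition arc (w : seq bool) (x y : nat) : bool :=
  [&& 0 < x, x < y, y <= size w, owner w x == owner w y
    & all (fun z => owner w z != owner w y) (iota x.+1 (y - x.+1))].

Lemma arcP q x y :
  reflect [/\ 0 < x, x < y, y <= N, owner (word q) x = owner (word q) y
    & forall z, x < z < y -> owner (word q) z <> owner (word q) y]
    (arc (word q) x y).
Proof.
rewrite /arc size_word.
apply: (iffP and5P) => -[x0 xy yN ow h]; split=> //.
- exact/eqP.
- by move=> z zxy; apply/eqP; apply: (allP h); rewrite mem_iota; lia.
- exact/eqP.
by apply/allP => z; rewrite mem_iota => zxy; apply/eqP; apply: h; lia.
Qed.

Lemma arc_right q x y : arc (word q) x y -> ~~ letter (word q) y.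
Proof.
move=> /arcP[x0 xy yN ow _]; apply/negP => l; move: ow; rewrite (owner_up l) => ow.
by have [] := @owner_bounds q x; rewrite ?ow; lia.
Qed.

Lemma arc_opener_uniq q x x' y :
  arc (word q) x y -> arc (word q) x' y -> x = x'.
Proof.
move=> /arcP[x0 xy yN ow h] /arcP[x0' xy' _ ow' h'].
case: (ltngtP x x') => // lt; last by case: (h' x); rewrite // lt.
by case: (h x'); rewrite // lt.
Qed.

Lemma arc_closer_uniq q x y y' :
  arc (word q) x y -> arc (word q) x y' -> y = y'.
Proof.
move=> /arcP[x0 xy yN ow h] /arcP[_ xy' yN' ow' h'].
case: (ltngtP y y') => // lt; last by case: (h y'); rewrite -?ow // lt xy'.
by case: (h' y); rewrite -?ow' // lt xy.
Qed.

Lemma last_before (P : pred nat) u v : u < v -> P u ->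
  exists x, [/\ u <= x, x < v, P x & forall z, x < z < v -> ~~ P z].
Proof.
elim: v => // v IH uv Pu; have [Pv|nPv] := boolP (P v).
  by exists v; split=> // z; lia.
have {}uv : u < v.
  by move: uv; rewrite ltnS leq_eqVlt => /orP[/eqP e|//]; rewrite -e Pu in nPv.
have [x [ux xv Px h]] := IH uv Pu; exists x; split=> // [|z /andP[xz]]; first exact: leqW.
by rewrite ltnS leq_eqVlt => /orP[/eqP->//|zv]; apply: h; rewrite xz.
Qed.

Lemma first_after (P : pred nat) u v : u < v -> P v ->
  exists x, [/\ u < x, x <= v, P x & forall z, u < z < x -> ~~ P z].
Proof.
move=> uv Pv; have ex : exists x, (u < x) && P x by exists v; rewrite uv.
case: (ex_minnP ex) => x /andP[ux Px] mn; exists x; split=> // [|z /andP[uz zx]].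
  by apply: mn; rewrite uv.
by apply: contraL zx => Pz; rewrite -leqNgt; apply: mn; rewrite uz.
Qed.

Lemma arc_opener q y : 0 < y <= N -> ~~ letter (word q) y ->
  exists x, arc (word q) x y.
Proof.
move=> yN nl; have [/andP[o0 oy] lo _ _] := ownerP yN nl.
have [|x [ox xy /eqP ow h]] :=
  @last_before (fun x => owner (word q) x == owner (word q) y) _ _ oy.
  by rewrite owner_up.
exists x; apply/arcP; split=> //; try lia.
by move=> z xzy; apply/eqP; apply: h.
Qed.

Lemma arc_before q x y : 0 < x -> x < y -> y <= N ->
  owner (word q) x = owner (word q) y -> exists2 z, x <= z & arc (word q) z y.
Proof.
move=> x0 xy yN ow.
have [|z [xz zy /eqP owz h]] :=
  @last_before (fun z => owner (word q) z == owner (word q) y) _ _ xy.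
  by rewrite ow.
by exists z => //; apply/arcP; split=> //; [lia | move=> t tzy; apply/eqP; apply: h].
Qed.

Lemma arc_after q x y : 0 < x -> x < y -> y <= N ->
  owner (word q) x = owner (word q) y -> exists2 z, z <= y & arc (word q) x z.
Proof.
move=> x0 xy yN ow.
have [|z [xz zy /eqP owz h]] :=
  @first_after (fun z => owner (word q) z == owner (word q) x) _ _ xy.
  by rewrite ow.
exists z => //; apply/arcP; split=> //; first by lia.
by move=> t tzy; rewrite owz; apply/eqP; apply: h.
Qed.

Lemma owner_promotion_eq q x y : 0 < x < N -> 0 < y < N ->
  (owner (word (promotion q)) x == owner (word (promotion q)) y) =
  (owner (word q) x.+1 == owner (word q) y.+1).
Proof.
move=> xN yN; rewrite !owner_promotion //.
have [/andP[l1 lN] ll _ _] := descentP q.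
have no z : 0 < z < N -> 0 < owner (word q) z.+1 /\ owner (word q) z.+1 != descent q.
  move=> zN; have [/andP[o0 _] lo _] := @owner_bounds q z.+1 ltac:(lia).
  by split=> //; apply: contraNneq ll => <-.
have [ox nx] := no x xN; have [oy ny] := no y yN.
move: (owner _ x.+1) (owner _ y.+1) (descent q) l1 nx ny ox oy => u v l l1 nx ny ox oy.
by case: (u =P 1); case: (v =P 1); lia.
Qed.

(** Arcs only depend on the partition into blocks, which promotion shifts. The
    bounds exclude the arc at the deleted step and the one at the new last
    step. *)
Lemma arc_promotion q x y : 0 < x -> y < N ->
  arc (word (promotion q)) x y = arc (word q) x.+1 y.+1.
Proof.
move=> x0 yN; rewrite /arc !size_word x0 ltnS (ltnW yN) yN /=.
have [xy|] := ltnP x y; last by rewrite !ltnS => yx; rewrite ltnNge yx.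
have yN' : 0 < y < N by lia.
rewrite ltnS xy owner_promotion_eq /=; [|lia|lia].
congr (_ && _); rewrite -[x.+2]add1n iotaDl all_map.
apply: eq_in_all => z; rewrite mem_iota => zxy /=.
by rewrite owner_promotion_eq //; lia.
Qed.

Lemma arc_first q y : arc (word q) 1 y -> y = descent q.
Proof.
have [/andP[l1 lN] ll lb lge] := descentP q.
move=> h; have nl := arc_right h; case/arcP: h => _ y1 yN ow between.
have ol : owner (word q) (descent q) = 1.
  apply: owner_eq; rewrite ?letter1 ?height0 //; try lia.
  by move=> u ul lu; apply: leq_trans lb (lge _ _); lia.
rewrite owner_up ?letter1 // in ow.
have := @block_height_right q y ltac:(lia) nl; rewrite -ow height0 add0n => yb.
case: (ltngtP y (descent q)) => // lt.
  by have := lge y ltac:(lia); lia.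
by case: (between (descent q)); rewrite ?l1 // ol.
Qed.

(** * Counting arcs *)

(** The windows are half-open, ]k, r]. *)
Definition arcs_within (w : seq bool) (k r : nat) : nat :=
  \sum_(1 <= x < (size w).+1) \sum_(1 <= y < (size w).+1)
     (arc w x y && ((k < x) && (y <= r))).

(** A sum of this form is a sum over at most one term; it turns sums over the
    openers or the closers of arcs into boolean conditions. *)
Lemma sum_bool_uniq (P : pred nat) m :
    (forall i j, P i -> P j -> i = j) ->
  \sum_(1 <= i < m.+1) P i = has P (iota 1 m) :> nat.
Proof.
move=> uP; rewrite /index_iota subn1 /=; elim: (iota 1 m) (iota_uniq 1 m) => [|i s IH] /=.
  by rewrite big_nil.
move=> /andP[is_ us]; rewrite big_cons IH //; case: (boolP (P i)) => //= Pi.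
suff -> : has P s = false by [].
apply/negbTE/hasPn => j js; apply/negP => Pj.
by rewrite (uP i j Pi Pj) js in is_.
Qed.

Lemma sum_openers q y : 0 < y <= N ->
  \sum_(1 <= x < N.+1) arc (word q) x y = ~~ letter (word q) y :> nat.
Proof.
move=> yN; rewrite sum_bool_uniq; last by move=> x x'; apply: arc_opener_uniq.
congr (nat_of_bool _); apply/hasP/idP => [[x _] /arc_right //|nl].
have [x axy] := arc_opener yN nl; exists x => //.
by rewrite mem_iota; case/arcP: axy; lia.
Qed.

Lemma rights_sum q r : r <= N ->
  rights (word q) r = \sum_(1 <= y < r.+1) ~~ letter (word q) y.
Proof.
elim: r => [|r IH] rN; first by rewrite /rights take0 big_nil.
by rewrite rightsS ?size_word // (IH (ltnW rN)) [RHS]big_nat_recr.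
Qed.

Lemma arcs0 q r : r <= N -> arcs_within (word q) 0 r = rights (word q) r.
Proof.
move=> rN; rewrite /arcs_within size_word exchange_big rights_sum //=.
rewrite [RHS](big_nat_widen _ _ N.+1) //= [RHS]big_mkcond /=.
apply: eq_big_nat => y yN; rewrite ltnS; case: leqP => _; last first.
  by apply: big1 => x _; rewrite !andbF.
rewrite -sum_openers //; apply: eq_big_nat => x /andP[-> _].
by rewrite !andbT.
Qed.

(** Iterating this moves every window to an initial one, where arcs are counted
    by their closers, the right steps. *)
Lemma arcs_promotion q k r : r < N ->
  arcs_within (word (promotion q)) k r = arcs_within (word q) k.+1 r.+1.
Proof.
move=> rN; rewrite /arcs_within !size_word.
have [M eM] : exists M, N = M.+1 by exists N.-1; lia.
have noN p x y : M < x -> arc (word p) x y = false.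
  by move=> Mx; apply/negP => /arcP[]; rewrite eM; lia.
have no1 p x : arc (word p) x 1 = false by apply/negP => /arcP[]; lia.
rewrite eM; rewrite eM in rN; rewrite big_nat_recr //= [X in _ + X]big1 ?addn0; last first.
  by move=> y _; rewrite noN.
rewrite [RHS]big_ltn // [X in X + _]big1 ?add0n; last by move=> y _; rewrite andbF.
rewrite [RHS]big_add1; apply: eq_big_nat => x /andP[x0 xM].
rewrite big_nat_recr //= [X in _ + nat_of_bool X](_ : _ = false) ?addn0; last first.
  by have -> : (M < r) = false by [apply/negbTE; lia]; rewrite !andbF.
rewrite [RHS]big_ltn // no1 add0n [RHS]big_add1; apply: eq_big_nat => y /andP[y0 yM].
by rewrite arc_promotion ?ltnS // eM.
Qed.

Lemma arcs_iter q k r : k <= r <= N ->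
  arcs_within (word q) k r = rights (word (iter k (@promotion a b n) q)) (r - k).
Proof.
elim: k q r => [|k IH] q r krN; first by rewrite arcs0 // subn0.
case: r krN => // r krN; rewrite -arcs_promotion; last by lia.
by rewrite IH ?iterSr //; lia.
Qed.

Lemma arcs_le q k r : k <= r <= N -> (a + b) * arcs_within (word q) k r <= b * (r - k).
Proof.
move=> krN; rewrite arcs_iter //.
by rewrite -(@rights_height (iter k (@promotion a b n) q)) ?leq_addr //; lia.
Qed.

(** By rotation it is enough to consider the arc at the first step. It closes at
    the descent, where one more right step would be too many for the line. *)
Lemma arcs_inside q x y : arc (word q) x y ->
  b * (y - x) < (a + b) * (arcs_within (word q) x y).+1.
Proof.
elim: x q y => [|x IH] q y; first by case/arcP.
move=> axy; have [_ xy yN _ _] := arcP _ _ _ axy.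
case: y xy yN axy => // y xy yN axy; case: x IH xy axy => [|x] IH xy axy.
  have ey := arc_first axy; have [/andP[l1 lN] ll lb lge] := descentP q.
  rewrite -arcs_promotion // (arcs0 _ (ltnW yN)).
  have := @rights_height (promotion q) y (ltnW yN).
  have := @height_promotion q y yN; rewrite -ey ltnn => -> e.
  by rewrite -ey in lb; rewrite subn1 /= -e mulnS; lia.
rewrite -arc_promotion // in axy.
by have := IH _ _ axy; rewrite arcs_promotion // subSS.
Qed.

(** * Counting selected positions *)

(** In a block, this is the order by maximal H-value, see
    [dominated_outranks]. For [x <= b * n < y = bar i] it says that the ceiling
    of [b * i / a] is less than [x]; the inequality also gives the right answer
    if [x] and [y] are both barred or both unbarred. *)
Definition outranks (x y : nat) : bool := b * (N + 1 - y) <= a * (x - 1).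

Definition beaten_opener (w : seq bool) (x : nat) : bool :=
  has (fun y => arc w x y && ~~ outranks x y) (iota 1 N).

Definition beaten_closer (w : seq bool) (y : nat) : bool :=
  has (fun x => arc w x y && outranks x y) (iota 1 N).

(** These turn out to be the selected positions, see [mem_selected]. *)
Definition unbeaten (w : seq bool) (v : nat) : bool :=
  [&& 0 < v, v <= N, ~~ beaten_opener w v & ~~ beaten_closer w v].

(** For a set [S] that is the set of entries of [K(p)], its elements up to
    [k <= b * n] are the columns of valleys, counted from the right, and the indices [t] with
    [bar t] not in [S] are the rows of valleys, counted from the top. *)
Definition columns_upto (S : pred nat) (k : nat) : nat := \sum_(1 <= v < k.+1) S v.

Definition rows_upto (S : pred nat) (i : nat) : nat :=
  \sum_(1 <= t < i.+1) ~~ S (bar a b n t).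

Definition outranking_arcs (w : seq bool) (k r : nat) : nat :=
  \sum_(1 <= x < (size w).+1) \sum_(1 <= y < (size w).+1)
     (arc w x y && [&& x <= k, y <= r & outranks x y]).

Lemma outranks_gt x y : x < y <= N -> outranks x y -> b * n < y.
Proof.
move=> xy; rewrite /outranks => h; rewrite ltnNge; apply/negP => yb.
have : b * (a * n + 1) <= a * (b * n).
  apply: leq_trans (leq_trans h _); rewrite leq_mul2l; apply/orP; right; lia.
by rewrite mulnCA mulnDr; lia.
Qed.

Lemma outranks_barred x y : b * n < x < y -> y <= N -> outranks x y.
Proof.
move=> xy yN; apply: (@leq_trans (b * (a * n))); first by rewrite leq_mul2l; lia.
by rewrite mulnCA leq_mul2l; lia.
Qed.

Lemma beaten_closer_gt q y : beaten_closer (word q) y -> b * n < y.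
Proof.
by case/hasP => x _ /andP[/arcP[x0 xy yN _ _]]; apply: outranks_gt; rewrite xy.
Qed.

Lemma beaten_opener_le q x : beaten_opener (word q) x -> x <= b * n.
Proof.
case/hasP => y _ /andP[/arcP[x0 xy yN _ _]]; apply: contraR; rewrite -ltnNge => xb.
by apply: outranks_barred; rewrite ?xb.
Qed.

Lemma rightsN q : rights (word q) N = b * n.
Proof.
by rewrite /rights -(size_word q) take_size; case/and3P: (valP q) => _ /eqP.
Qed.

Lemma arcs_total q :
  \sum_(1 <= x < N.+1) \sum_(1 <= y < N.+1) arc (word q) x y = b * n.
Proof.
rewrite -(rightsN q) -arcs0 // /arcs_within size_word.
apply: eq_big_nat => x /andP[x0 _]; apply: eq_big_nat => y /andP[_ yN].
by rewrite x0 (_ : y <= N) // !andbT.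
Qed.

Lemma columns_unbeaten q k : k <= b * n ->
  columns_upto (unbeaten (word q)) k +
  \sum_(1 <= x < N.+1) \sum_(1 <= y < N.+1)
    (arc (word q) x y && ((x <= k) && ~~ outranks x y)) = k.
Proof.
move=> kb; have kN : k <= N by lia.
rewrite (@big_cat_nat _ _ _ k.+1) //= [X in _ + (_ + X)]big_nat.
rewrite [X in _ + (_ + X)]big1 ?addn0; last first.
  by move=> x /andP[kx _]; apply: big1 => y _; rewrite leqNgt kx andbF.
rewrite /columns_upto -big_split /= -[RHS](subn1 k.+1) -[RHS]muln1 -sum_nat_const_nat.
apply: eq_big_nat => x /andP[x0 xk].
rewrite (eq_bigr (fun y => nat_of_bool (arc (word q) x y && ~~ outranks x y))); last first.
  by move=> y _; rewrite (_ : x <= k).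
rewrite (@sum_bool_uniq (fun y => arc (word q) x y && ~~ outranks x y)); last first.
  by move=> y y' /andP[h _] /andP[h' _]; apply: arc_closer_uniq h h'.
rewrite -/(beaten_opener _ _) /unbeaten x0 (_ : x <= N); last by lia.
have -> : beaten_closer (word q) x = false.
  by apply/negP => /beaten_closer_gt; lia.
by case: beaten_opener.
Qed.

Lemma rows_unbeaten q i : i <= a * n ->
  \sum_(1 <= x < N.+1) \sum_(1 <= y < N.+1)
    (arc (word q) x y && ((N - i < y) && outranks x y)) =
  rows_upto (unbeaten (word q)) i.
Proof.
move=> ia; have iN : N - i <= N by lia.
rewrite exchange_big /= (@big_cat_nat _ _ _ (N - i).+1) //= [X in X + _]big_nat.
rewrite [X in X + _]big1 ?add0n; last first.
  by move=> y /andP[_ yi]; apply: big1 => x _; rewrite ltnNge (_ : y <= N - i) // andbF.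
rewrite -[(N - i).+1]add1n big_addn subSn // subKn; last by lia.
rewrite big_nat_rev /rows_upto; apply: eq_big_nat => t /andP[t0 ti].
have -> : 1 + i.+1 - t.+1 + (N - i) = bar a b n t by rewrite /bar; lia.
set y := bar a b n t.
rewrite (eq_bigr (fun x => nat_of_bool (arc (word q) x y && outranks x y))); last first.
  by move=> x _; rewrite (_ : N - i < _) //; rewrite /y /bar; lia.
rewrite (@sum_bool_uniq (fun x => arc (word q) x _ && outranks x _)); last first.
  by move=> x x' /andP[h _] /andP[h' _]; apply: arc_opener_uniq h h'.
rewrite -/(beaten_closer _ _) /unbeaten.
have -> : beaten_opener (word q) y = false.
  by apply/negP => /beaten_opener_le; rewrite /y /bar; lia.
have -> : 0 < y by rewrite /y /bar; lia.
have -> : y <= N by rewrite /y /bar; lia.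
by case: beaten_closer.
Qed.

(** Each of the [b * n] arcs falls under exactly one of these cases: it lies
    inside the window ]k, N - i]; its opener is at most [k] and is beaten; its
    closer exceeds [N - i] and is beaten; its opener is at most [k], its closer is
    at most [N - i], and the opener outranks the closer. Indeed, by the last
    hypothesis, the opener outranks the closer if it exceeds [k] and the closer
    exceeds [N - i]. *)
Lemma unbeaten_count q k i : k <= b * n -> i <= a * n -> b * i <= a * k ->
  columns_upto (unbeaten (word q)) k + (b * n - k) =
  rows_upto (unbeaten (word q)) i + arcs_within (word q) k (N - i)
  + outranking_arcs (word q) k (N - i).
Proof.
move=> kb ia ik; have eJ := columns_unbeaten q kb; have eI := rows_unbeaten q ia.
suff : b * n = \sum_(1 <= x < N.+1) \sum_(1 <= y < N.+1)
    (arc (word q) x y && ((x <= k) && ~~ outranks x y)) +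
  \sum_(1 <= x < N.+1) \sum_(1 <= y < N.+1)
    (arc (word q) x y && ((N - i < y) && outranks x y)) +
  arcs_within (word q) k (N - i) + outranking_arcs (word q) k (N - i).
  by rewrite eI; lia.
rewrite -(arcs_total q) /arcs_within /outranking_arcs size_word -!big_split /=.
apply: eq_big_nat => x /andP[x0 xN]; rewrite -!big_split /=.
apply: eq_big_nat => y /andP[y0 yN].
case: (arc _ x y) => //=.
have gd : k < x -> N - i < y -> outranks x y.
  move=> kx iy; rewrite /outranks; apply: (@leq_trans (b * i)).
    by rewrite leq_mul2l; lia.
  by apply: leq_trans ik _; rewrite leq_mul2l; lia.
case: (leqP x k) gd => xk; case: (leqP y (N - i)) => yi; case: (outranks x y) => //=.
by move=> /(_ isT isT).
Qed.

Lemma arcs_succ q k r : arcs_within (word q) k r <= arcs_within (word q) k.+1 r + 1.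
Proof.
have -> : arcs_within (word q) k r = arcs_within (word q) k.+1 r +
    \sum_(1 <= x < N.+1) \sum_(1 <= y < N.+1)
      (arc (word q) x y && ((x == k.+1) && (y <= r))).
  rewrite /arcs_within size_word -big_split /=; apply: eq_big_nat => x _.
  rewrite -big_split /=; apply: eq_big_nat => y _.
  case: (arc _ _ _) => //=; case: (y <= r); rewrite ?andbF ?andbT //=.
  rewrite [k < x]leq_eqVlt eq_sym; case: eqP => [->|_]; first by rewrite ltnn.
  by rewrite addn0.
rewrite leq_add2l.
rewrite (eq_bigr (fun x => nat_of_bool
  (has (fun y => arc (word q) x y && ((x == k.+1) && (y <= r))) (iota 1 N)))); last first.
  move=> x _; rewrite (@sum_bool_uniq (fun y => _ && _)) //.
  by move=> y y' /andP[h _] /andP[h' _]; apply: arc_closer_uniq h h'.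
rewrite (@sum_bool_uniq (fun x => has _ _)); first by case: has.
by move=> x x' /hasP[y _ /andP[_ /andP[/eqP-> _]]] /hasP[y' _ /andP[_ /andP[/eqP-> _]]].
Qed.

Lemma arcs_leq q x k y r : x <= k -> y <= r ->
  arcs_within (word q) x y <= arcs_within (word q) k r + (k - x).
Proof.
move=> xk yr; apply: (@leq_trans (arcs_within (word q) x r)).
  apply: leq_sum => u _; apply: leq_sum => v _.
  case: (arc _ u v) => //=; case: (x < u) => //=; case: (leqP v y) => // vy.
  by rewrite (leq_trans vy yr).
rewrite -(subnKC xk); elim: (k - x) => [|d IH]; first by rewrite addn0 subnn addn0.
apply: leq_trans IH _; have := arcs_succ q (x + d) r; rewrite (addnS x d); lia.
Qed.

(** An arc whose opener outranks its closer is so long that, by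
    [arcs_inside], the window between its ends already has one arc more
    than the columns that remain. Raising the left end of a window by one loses
    at most one arc, as well as one column. *)
Lemma outranking_arcs_gt0 q k r : k <= b * n -> 0 < outranking_arcs (word q) k r ->
  b * n - k < arcs_within (word q) k r.
Proof.
move=> kb; rewrite lt0n => nz.
have [x [y [axy xk yr g]]] :
    exists x y, [/\ arc (word q) x y, x <= k, y <= r & outranks x y].
  case: (boolP (has (fun x => has (fun y => arc (word q) x y &&
    [&& x <= k, y <= r & outranks x y]) (iota 1 N)) (iota 1 N))) => [/hasP[x _]|no].
    by case/hasP => y _ /andP[h /and3P[? ? ?]]; exists x, y.
  case/negP: nz; apply/eqP; rewrite /outranking_arcs size_word.
  apply: big1_seq => x /andP[_]; rewrite mem_index_iota => xN.
  apply: big1_seq => y /andP[_]; rewrite mem_index_iota => yN.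
  apply/eqP; rewrite eqb0; apply: contra no => h.
  by apply/hasP; exists x; rewrite ?mem_iota //; apply/hasP; exists y; rewrite ?mem_iota.
have [x0 xy yN _ _] := arcP _ _ _ axy.
have h1 := arcs_inside axy; have h2 := arcs_leq q xk yr.
suff : (a + b) * (b * n + 1 - x) < (a + b) * (arcs_within (word q) x y).+1.
  by rewrite ltn_mul2l; lia.
apply: leq_trans h1; rewrite ltnS.
move: g; rewrite /outranks -(leq_add2r (b * y)) -mulnDr subnK; last by lia.
have -> : b * (N + 1) = a * (b * n) + b * (b * n) + b.
  by rewrite mulnDr muln1 mulnDl mulnDr (mulnCA b a).
have [d ed] : exists d, b * n = d + (x - 1) by exists (b * n - (x - 1)); lia.
have -> : b * n + 1 - x = d by lia.
have -> : b * y = b * (y - x) + b * (x - 1) + b.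
  by rewrite -mulnDr -mulnSr; congr (_ * _); lia.
by rewrite ed mulnDl !mulnDr; lia.
Qed.

(** A window belongs to a walk that starts on the line at its left end, by
    [arcs_iter]; for a box below the line this is too few right steps. *)
Lemma arcs_below q k t : 0 < k <= b * n -> 0 < t <= a * n ->
  a * (k - 1) < b * t -> arcs_within (word q) k (N + 1 - t) <= b * n - k.
Proof.
move=> kb ta lt; have h := @arcs_le q k (N + 1 - t) ltac:(lia).
suff : (a + b) * arcs_within (word q) k (N + 1 - t) < (a + b) * (b * n - k).+1.
  by rewrite ltn_mul2l; lia.
apply: leq_ltn_trans h _.
have [d ed] : exists d, b * n = d + (k - 1) + 1 by exists (b * n - k); lia.
have [e ee] : exists e, a * n = e + t by exists (a * n - t); lia.
have -> : N + 1 - t - k = (d + e).+1 by lia.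
have -> : b * n - k = d by lia.
have := mulnCA a b n; rewrite ed ee !mulnS mulnDl !mulnDr muln1; lia.
Qed.

(** For a box above the line this is [unbeaten_count], where
    [outranking_arcs_gt0] removes the last term. For a box below the line both
    sides are false; by monotonicity, it is enough to see this for the left one
    at the leftmost box of the row that is below the line, in column [c]. *)
Lemma unbeaten_window q k t : 0 < k <= b * n -> 0 < t <= a * n ->
  (rows_upto (unbeaten (word q)) t.-1 < columns_upto (unbeaten (word q)) k) =
  (b * n - k < arcs_within (word q) k (N + 1 - t)).
Proof.
move=> kb ta; have e : N - t.-1 = N + 1 - t by lia.
have [above|below] := leqP (b * t) (a * (k - 1)).
  have ineq : b * t.-1 <= a * k.
    by apply: leq_trans (leq_trans above _); rewrite leq_mul2l; lia.
  have := @unbeaten_count q k t.-1 ltac:(lia) ltac:(lia) ineq; rewrite e.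
  have [g0|gp] := posnP (outranking_arcs (word q) k (N + 1 - t)); first by lia.
  by have := @outranking_arcs_gt0 q k _ ltac:(lia) gp; lia.
have rf : (b * n - k < arcs_within (word q) k (N + 1 - t)) = false.
  by apply/negbTE; rewrite -leqNgt; apply: arcs_below.
rewrite rf; apply/negbTE; rewrite -leqNgt.
have exc : exists c, b * t <= a * c.
  by exists (b * n); rewrite mulnCA leq_mul2l; lia.
case: (ex_minnP exc) => c tc mn.
have cb : c <= b * n by apply: mn; rewrite mulnCA leq_mul2l; lia.
have kc : k <= c.
  rewrite leqNgt; apply/negP => ck; move: below; rewrite ltnNge => /negP[].
  by apply: leq_trans tc _; rewrite leq_mul2l; lia.
have lt : a * (c - 1) < b * t.
  by rewrite ltnNge; apply/negP => /mn; lia.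
have mono : columns_upto (unbeaten (word q)) k <= columns_upto (unbeaten (word q)) c.
  by rewrite /columns_upto [X in _ <= X](@big_cat_nat _ _ _ k.+1) //= leq_addr.
apply: leq_trans mono _.
have ineq : b * t.-1 <= a * c by apply: leq_trans tc; rewrite leq_mul2l; lia.
have := @unbeaten_count q c t.-1 cb ltac:(lia) ineq; rewrite e.
have -> : outranking_arcs (word q) c (N + 1 - t) = 0.
  apply: big1 => x _; apply: big1 => y _; apply/eqP; rewrite eqb0.
  apply/negP => /andP[/arcP[x0 xy yN _ _] /and3P[xc yt]]; rewrite /outranks => g.
  suff : b * t <= a * (c - 1) by rewrite leqNgt lt.
  apply: (@leq_trans (b * (N + 1 - y))); first by rewrite leq_mul2l; lia.
  by apply: leq_trans g _; rewrite leq_mul2l; lia.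
have c0 : 0 < c <= b * n by lia.
by have := arcs_below q c0 ta lt; lia.
Qed.

Lemma unbeaten_window_rowmotion q k t : 0 < k <= b * n -> 0 < t <= a * n ->
    b * t <= a * (k - 1) ->
  (rows_upto (unbeaten (word q)) t <= columns_upto (unbeaten (word q)) k.-1) =
  (b * n - k < arcs_within (word q) k.-1 (N - t)).
Proof.
move=> kb ta; rewrite subn1 => above.
have := @unbeaten_count q k.-1 t ltac:(lia) ltac:(lia) above.
have [g0|gp] := posnP (outranking_arcs (word q) k.-1 (N - t)); first by lia.
by have := @outranking_arcs_gt0 q k.-1 _ ltac:(lia) gp; lia.
Qed.

Lemma unbeaten_balanced q :
  rows_upto (unbeaten (word q)) (a * n) = columns_upto (unbeaten (word q)) (b * n).
Proof.
have := @unbeaten_count q (b * n) (a * n) (leqnn _) (leqnn _).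
rewrite mulnCA leqnn => /(_ isT); rewrite subnn addn0 => ->.
have -> : N - a * n = b * n by lia.
rewrite [arcs_within _ _ _]big1 ?[outranking_arcs _ _ _]big1 ?addn0 //.
  move=> x _; apply: big1 => y _; apply/eqP; rewrite eqb0; apply/negP.
  move=> /andP[axy /and3P[_ yb g]].
  suff /beaten_closer_gt : beaten_closer (word q) y by lia.
  by apply/hasP; exists x; rewrite ?axy // mem_iota; case/arcP: axy; lia.
move=> x _; apply: big1 => y _; apply/eqP; rewrite eqb0; apply/negP.
by move=> /andP[/arcP[x0 xy _ _ _]]; lia.
Qed.

(** * Rays *)

Section RayEquations.
Local Open Scope ring_scope.
Variables (c d h x0 y0 : nat).

Lemma ray_at_height y : (0 < c)%N -> (d * y0 = h + c * x0)%N -> (h <= d * y)%N ->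
  x0%:R + d%:R / c%:R * (y%:R - y0%:R) = (d * y - h)%N%:R / c%:R :> rat.
Proof.
move=> c0 e hy; rewrite (natrB _ hy) natrM.
have -> : h%:R = d%:R * y0%:R - c%:R * x0%:R :> rat by rewrite -!natrM e natrD addrK.
by field; rewrite pnatr_eq0 -lt0n.
Qed.

Lemma ray_at_abscissa x : (0 < d)%N -> (d * y0 = h + c * x0)%N ->
  y0%:R + c%:R / d%:R * (x%:R - x0%:R) = (h + c * x)%N%:R / d%:R :> rat.
Proof.
move=> d0 e; rewrite natrD natrM.
have -> : h%:R = d%:R * y0%:R - c%:R * x0%:R :> rat by rewrite -!natrM e natrD addrK.
by field; rewrite pnatr_eq0 -lt0n.
Qed.

End RayEquations.

Lemma head_pmap (T : Type) (d z : T) (f : nat -> option T) m k : k < m ->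
  f k = Some z -> (forall j, j < k -> f j = None) -> head d (pmap f (iota 0 m)) = z.
Proof.
move=> km fk none; rewrite -(subnKC (ltnW km)) iotaD pmap_cat add0n.
have -> : pmap f (iota 0 k) = [::].
  elim: k {km fk} none => // k IH none; rewrite -addn1 iotaD pmap_cat /= add0n.
  by rewrite IH ?none // => j jk; apply: none; apply: ltnW.
by case: (m - k) (subn_gt0 k m) => [|r _] /=; [rewrite km | rewrite fk].
Qed.

Lemma up_posP q m : 0 < m <= a * n ->
  [/\ 0 < up_pos (word q) m <= N, letter (word q) (up_pos (word q) m),
      ups (word q) (up_pos (word q) m).-1 = m.-1,
      rights (word q) (up_pos (word q) m).-1 = xcoord (word q) m
    & xcoord (word q) m + m = up_pos (word q) m].
Proof.
move=> ma; have ms : 0 < m <= size (up_positions (word q)) by rewrite size_up_positions.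
have := mem_up_pos ms; rewrite mem_up_positions size_word => /and3P[u0 uN lu].
have e := ups_up_pos ms; have mu := up_pos_gt0 ms.
have xm : xcoord (word q) m + m = up_pos (word q) m by rewrite /xcoord subnK.
have um : ups (word q) (up_pos (word q) m).-1 = m.-1.
  by move: e; rewrite -{1}(prednK u0) upsS ?prednK ?size_word // lu; lia.
split=> //; first by rewrite u0.
by have := @ups_rights (word q) (up_pos (word q) m).-1; rewrite size_word um /xcoord; lia.
Qed.

(** The ray of an up step that starts at height [h0] consists of the points of
    height [h0], so it meets the path in the first later step [e] that ends at
    height at most [h0]. *)
Lemma first_hitP q m : 0 < m <= a * n ->
  let u := up_pos (word q) m in
  let h0 := height (word q) u.-1 in
  exists e, [/\ u < e <= N, ~~ letter (word q) e, height (word q) e <= h0,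
    forall i, u <= i < e -> h0 < height (word q) i
  & forall v : nat, let: (s, t) := first_hit a b (word q) m in
      (v%:R <= (Num.floor s)%:~R + t :> rat)%R =
      (v <= e.-1 + (height (word q) e == h0))].
Proof.
move=> ma u h0; have [/andP[u0 uN] lu eu er ex] := up_posP q ma.
rewrite -/u in u0 uN lu eu er ex.
have hu : height (word q) u = h0 + b.
  by rewrite /h0 -{1}(prednK u0) height_up ?prednK.
have uN' : u < N.
  by rewrite ltn_neqAle uN andbT; apply: contraTneq lu => ->; apply: letterN.
have [|e [ue eN he before]] := @first_after (fun i => height (word q) i <= h0) u N uN'.
  by rewrite heightN.
have gt i : u <= i < e -> h0 < height (word q) i.
  case/andP; rewrite leq_eqVlt => /orP[/eqP<- _|ui ie]; first by rewrite hu; lia.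
  by rewrite ltnNge before // ui.
have nle : ~~ letter (word q) e.
  apply/negP => l; have := gt e.-1 ltac:(lia).
  by case: e ue eN he l {before gt} => // e ue eN he l /=; rewrite height_up // in he; lia.
exists e; split=> //; first by rewrite ue.
have A0 : (0 < a%:R :> rat)%R by rewrite ltr0n.
have B0 : (0 < b%:R :> rat)%R by rewrite ltr0n.
have above i : i <= N -> b * ups (word q) i = height (word q) i + a * rights (word q) i.
  by move=> iN; rewrite /height subnK // dyck_above.
have e0 : b * m.-1 = h0 + a * xcoord (word q) m.
  by have := above u.-1; rewrite eu er; apply; lia.
set X0 := xcoord (word q) m in e0 *; set M := m.-1 in e0 *.
have sE Y := @ray_at_height _ _ _ _ _ Y a_gt0 e0.
have tE X := @ray_at_abscissa _ _ _ _ _ X b_gt0 e0.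
set X := rights (word q) e.-1; set Y := ups (word q) e.-1.
have e1 : e.-1.+1 = e by lia.
have eY : ups (word q) e = Y.
  by rewrite /Y -{1}e1 upsS ?e1 ?size_word // (negbTE nle) addn0.
have eX : rights (word q) e = X.+1.
  by rewrite /X -{1}e1 rightsS ?e1 ?size_word // nle addn1.
have hY : b * Y = height (word q) e + a * X.+1 by rewrite -eY above // eX.
have hY' : b * Y = height (word q) e.-1 + a * X by rewrite above //; lia.
have h1 : h0 < height (word q) e.-1 by apply: gt; lia.
have mY : M < Y.
  have := @leq_ups (word q) u e.-1 ltac:(lia).
  by rewrite /u ups_up_pos ?size_up_positions //; lia.
have bMY : b * M + b <= b * Y by rewrite -mulnSr leq_mul2l mY orbT.
(* No step before e meets the ray: up to the start of the ray, they do not reach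
   beyond its starting point, and after it they stay strictly above the ray. *)
have hit : first_hit a b (word q) m = ((b * Y - h0)%:R / a%:R, Y%:R)%R.
  apply: (@head_pmap _ _ _ _ _ e.-1); first by rewrite size_word; lia.
    rewrite /ray_hit e1 (negbTE nle) -/X -/Y -/X0 -/M /= sE; last by lia.
    rewrite ifT // ltr_pdivlMr // ler_pdivlMr // ler_pdivrMr // -mulrSr -!natrM.
    rewrite !ltr_nat !ler_nat.
    have aX : a * X0 < b * Y - h0 by lia.
    by rewrite -!(mulnC a); lia.
  move=> j je; rewrite /ray_hit; have [l|l] := boolP (letter (word q) j.+1).
    rewrite eqxx tE -/X0 ltr_nat ler_pdivlMr // -natrM ler_nat.
    have [ju|uj] := ltnP j u.
      by have := @leq_rights (word q) j u.-1 ltac:(lia); rewrite er ltnNge => ->.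
    have := gt j ltac:(lia); have := above j ltac:(lia); rewrite (mulnC b) => ->.
    by move=> hj; rewrite leq_add2r [height _ _ <= h0]leqNgt hj andbF.
  rewrite /=; have [ju|uj] := ltnP j u.
    have jM : ups (word q) j <= M.
      by have := @leq_ups (word q) j u.-1 ltac:(lia); rewrite eu.
    rewrite ifF //; apply/negbTE; rewrite negb_and -leNgt gerDl.
    by rewrite mulr_ge0_le0 ?divr_ge0 ?ler0n // subr_le0 ler_nat jM.
  have hj := gt j ltac:(lia); have hj1 := gt j.+1 ltac:(lia).
  have ej := above j ltac:(lia); have ej1 := @height_right q j ltac:(lia) l.
  rewrite -/X0 -/M sE; last by lia.
  rewrite [X in _ && (_ && X)](_ : _ = false) ?andbF //.
  rewrite -mulrSr ler_pdivrMr // -natrM ler_nat mulSn (mulnC _ a); lia.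
move=> v; rewrite hit.
have -> : Num.floor ((b * Y - h0)%:R / a%:R : rat)%R = Posz (X + (height (word q) e == h0)).
  apply: floor_def; rewrite ler_pdivlMr // ltr_pdivrMr // -PoszD addn1 -!pmulrn -!natrM.
  rewrite ler_nat ltr_nat !(mulnC _ a); case: eqP => [e2|ne] /=; rewrite ?addn0 ?addn1.
    by rewrite hY e2 addKn leqnn /= mulnS; lia.
  by rewrite mulnS in hY *; lia.
rewrite -pmulrn -natrD ler_nat; congr (_ <= _).
by have := @ups_rights (word q) e.-1; rewrite size_word -/X -/Y; lia.
Qed.

(** * The perfect matching and the selected positions *)

(** A right step before the point [e] where the ray meets the path ends above the
    ray, and one after it that ends weakly above the ray is hidden from the up
    step by a later up step. The step at [e] itself ends at the height of the ray
    or below it, and taking the integer part of the abscissa excludes it in the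
    second case. *)
Lemma ray_owner q m v : 0 < m <= a * n ->
    0 < v <= N -> ~~ letter (word q) v -> owner (word q) v <= up_pos (word q) m ->
  (let: (s, t) := first_hit a b (word q) m in
   (xcoord (word q) m + m + 1 <= v) && (v%:R <= (Num.floor s)%:~R + t :> rat)%R) =
  (owner (word q) v == up_pos (word q) m).
Proof.
move=> ma vN nl ou; have [/andP[u0 uN] lu _ _ ->] := up_posP q ma.
have [e [/andP[ue eN] nle he gt]] := first_hitP q ma.
case: first_hit => s t ->; rewrite addn1.
have [/andP[o0 ov] lo ho hid] := ownerP vN nl.
move: (up_pos (word q) m) u0 uN lu ou ue he gt => u u0 uN lu ou ue he gt.
apply/andP/eqP => [[uv ve]|e1].
  have hv : height (word q) u.-1 <= height (word q) v.
    have [ve'|ev] := ltnP v e; first by apply/ltnW/gt; lia.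
    by move: ve; case: eqP => [<-|_] /= ve; [have -> : v = e by lia | lia].
  case: (ltngtP (owner (word q) v) u) ou => // ou _.
  by have := hid u ltac:(lia) lu; lia.
rewrite e1 in ho hid ov; split=> //.
have [ve|ev] := ltnP v e; first by lia.
have [ve|nve] := v =P e.
  have -> : (height (word q) e == height (word q) u.-1) = true.
    by rewrite eqn_leq he -[X in _ <= height _ X]ve ho.
  by lia.
case: v vN nl ou o0 ov lo ho hid e1 ev nve => // v vN nl ou o0 ov lo ho hid e1 ev nve.
have hv := @height_right q v ltac:(lia) nl.
have [|| u' [eu' lu' hu']] := @up_crossing q e v (height (word q) v.+1); try lia.
by have := hid u' ltac:(lia) lu'; lia.
Qed.

Lemma ups_owner q v m : 0 < v <= N -> 0 < m <= a * n ->
  (ups (word q) (owner (word q) v) == m) = (owner (word q) v == up_pos (word q) m).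
Proof.
move=> vN ma; have [/andP[o0 ov] lo _] := owner_bounds q vN.
apply/eqP/eqP => [<-|->]; last by rewrite ups_up_pos // size_up_positions.
by rewrite up_pos_ups // size_word; lia.
Qed.

Lemma mem_block q V m : 0 < m <= a * n ->
    (forall v, (v \in V) = [&& 0 < v <= N, ~~ letter (word q) v
                             & ups (word q) (owner (word q) v) <= m]) ->
  block a b (word q) V m =i
  [pred v | (0 < v <= N) && (owner (word q) v == up_pos (word q) m)].
Proof.
move=> ma hV v; rewrite /block.
have [/andP[u0 uN] lu _ _ _] := up_posP q ma.
have [vN|nvN] := boolP (0 < v <= N); last first.
  rewrite [RHS]inE (negbTE nvN); apply/negbTE; apply: contra nvN.
  case: first_hit => s t; rewrite inE => /orP[/eqP->|]; first by rewrite u0.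
  by rewrite mem_filter hV => /andP[_ /andP[]].
rewrite [RHS]inE vN /=.
have [l|nl] := boolP (letter (word q) v).
  rewrite (owner_up l); case: first_hit => s t.
  by rewrite inE mem_filter hV l andbF andbF orbF.
have vu : (v == up_pos (word q) m) = false by apply: contraNF nl => /eqP->.
have [om|mo] := leqP (ups (word q) (owner (word q) v)) m.
  rewrite -ray_owner //; last first.
    have [/andP[o0 ov] lo _] := owner_bounds q vN.
    rewrite leqNgt; apply/negP => lt; move: om.
    have := @leq_ups (word q) (up_pos (word q) m) (owner (word q) v).-1 ltac:(lia).
    rewrite ups_up_pos ?size_up_positions //.
    case: (owner _ v) o0 ov lo {lt} => // o _ ov lo /=.
    by rewrite upsS ?size_word ?lo; lia.
  by case: first_hit => s t; rewrite inE vu mem_filter hV vN nl om !andbT.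
rewrite -ups_owner // gtn_eqF //; case: first_hit => s t.
by rewrite inE vu mem_filter hV [ups _ _ <= m]leqNgt mo !andbF.
Qed.

(** The right steps still available when block [m] is built are those whose
    owners have not been treated yet. *)
Lemma mem_blocks q V m : m <= a * n ->
    (forall v, (v \in V) = [&& 0 < v <= N, ~~ letter (word q) v
                             & ups (word q) (owner (word q) v) <= m]) ->
  (forall B, B \in blocks a b (word q) V m -> exists u, forall v,
     (v \in B) = (0 < v <= N) && (owner (word q) v == u)) /\
  (forall k, 0 < k <= m -> exists2 B, B \in blocks a b (word q) V m & forall v,
     (v \in B) = (0 < v <= N) && (owner (word q) v == up_pos (word q) k)).
Proof.
elim: m V => [|m IH] V ma hV; first by split=> // k; lia.
have hB := @mem_block q V m.+1 ma hV.
have [|v|IH1 IH2] := IH [seq v <- V | v \notin block a b (word q) V m.+1]; first by lia.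
  rewrite mem_filter hB inE hV.
  have [vN|] := boolP (0 < v <= N); last by rewrite andbF.
  rewrite -ups_owner //; case: (letter _ _); rewrite ?andbF //=.
  by rewrite -[in RHS]ltnS; case: ltngtP.
split=> [B|k /andP[k0]].
  by rewrite /= inE => /orP[/eqP->|/IH1 //]; exists (up_pos (word q) m.+1) => v; apply: hB.
rewrite leq_eqVlt => /orP[/eqP->|km].
  by exists (block a b (word q) V m.+1); [rewrite /= inE eqxx | move=> v; apply: hB].
have [|B hBk eB] := IH2 k; first by rewrite k0.
by exists B => //; rewrite /= inE hBk orbT.
Qed.

Lemma mem_perfect_matching q :
  (forall B, B \in perfect_matching q -> exists u, forall v,
     (v \in B) = (0 < v <= N) && (owner (word q) v == u)) /\
  (forall v, 0 < v <= N -> exists2 B, B \in perfect_matching q & forall v',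
     (v' \in B) = (0 < v' <= N) && (owner (word q) v' == owner (word q) v)).
Proof.
have ups_le v : ups (word q) v <= a * n.
  have -> : a * n = ups (word q) (size (word q)).
    by rewrite /ups take_size; case/and3P: (valP q) => /eqP.
  have [vs|/ltnW vs] := leqP v (size (word q)); first exact: leq_ups.
  by rewrite /ups take_size take_oversize.
have [|h1 h2] := @mem_blocks q (right_positions (word q)) (a * n) (leqnn _).
  move=> v; rewrite mem_filter mem_iota size_word ups_le andbT.
  by rewrite eqbF_neg andbC; congr (_ && _); lia.
split=> // v vN; have [/andP[o0 ov] lo _] := owner_bounds q vN.
have uo := @up_pos_ups (word q) (owner (word q) v).
rewrite size_word in uo.
have [|B hB eB] := h2 (ups (word q) (owner (word q) v)).
  rewrite ups_le andbT; case: (owner _ _) o0 ov lo {uo} => // o _ ov lo.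
  by rewrite upsS ?size_word ?lo ?addn1 //; lia.
by exists B => // v'; rewrite eB uo //; lia.
Qed.

(** One of the comparisons in [is_selected]. *)
Definition dominated (v' v : nat) : bool :=
  (H_value a b n v' < H_value a b n v)%R
  || (H_value a b n v' == H_value a b n v) && (barred b n v' ==> barred b n v).

Lemma ceil_le_nat c d k : 0 < c ->
  (Num.ceil (d%:R / c%:R : rat) <= Posz k)%R = (d <= c * k).
Proof.
move=> c0; rewrite ceil_le_int ler_pdivrMr ?ltr0n // -pmulrn -natrM ler_nat.
by rewrite mulnC.
Qed.

(** Two barred positions of a block do not tie, as they are at least [a / b]
    apart by [block_gap]. *)
Lemma dominated_outranks q v v' : 0 < v -> v < v' -> v' <= N ->
    owner (word q) v = owner (word q) v' ->
  dominated v' v = outranks v v' /\ dominated v v' = ~~ outranks v v'.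
Proof.
move=> v0 vv' v'N ow; rewrite /dominated /H_value /barred.
have [v'b|bv'] := leqP v' (b * n).
  have -> : outranks v v' = false by apply/negbTE/negP => /outranks_gt; lia.
  by rewrite !ifF ?ltz_nat ?eqz_nat; lia.
have [vb|bv] := leqP v (b * n); last first.
  have gap := block_gap v0 vv' v'N ow; rewrite outranks_barred ?bv //.
  suff lt : (Num.ceil ((b * bar a b n v')%:R / a%:R : rat) <
             Num.ceil ((b * bar a b n v)%:R / a%:R : rat))%R.
    by split; [rewrite lt | rewrite (lt_gtF lt) (gt_eqF lt)].
  set c := Num.ceil (_ / _ : rat)%R.
  apply: (@lt_le_trans _ _ (c + 1)%R); first by rewrite ltrDl.
  rewrite -(@intrKceil rat 1%R) -ceilDrz ?intr_int //; apply: le_ceil.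
  have A0 : (0 < a%:R :> rat)%R by rewrite ltr0n.
  rewrite ler_pdivlMr // mulrDl divfK ?lt0r_neq0 // mul1r -natrD ler_nat.
  have -> : bar a b n v = bar a b n v' + (v' - v) by rewrite /bar; lia.
  by rewrite mulnDr leq_add2l.
have key : (Num.ceil ((b * bar a b n v')%:R / a%:R : rat) < Posz v)%R = outranks v v'.
  rewrite -{1}(prednK v0) -addn1 PoszD ltzD1 ceil_le_nat // /outranks /bar.
  by rewrite subn1.
rewrite /= -key; set c := Num.ceil _; split; first by rewrite andbF orbF.
by rewrite andbT -leNgt le_eqVlt orbC.
Qed.

(** Along a block, positions increase, so that an opener that outranks its closer
    outranks all later elements, and a closer that outranks its opener outranks
    all earlier ones. It is enough to compare the ends of arcs. *)
Lemma mem_selected q v : (v \in selected q) = unbeaten (word q) v.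
Proof.
have [pm1 pm2] := mem_perfect_matching q.
apply/flatten_mapP/and4P => [[B hB]|[v0 vN nb ng]].
  rewrite mem_filter => /andP[/allP sel vB]; have [u eB] := pm1 B hB.
  move: (vB); rewrite eB => /andP[/andP[v0 vN] /eqP ov].
  split=> //; apply/negP.
    case/hasP => y _ /andP[/arcP[_ vy yN ow _] /negP[]].
    have /sel : y \in B by rewrite eB -ow ov eqxx andbT; lia.
    by rewrite -/(dominated y v) (dominated_outranks v0 vy yN ow).1.
  case/hasP => x _ /andP[/arcP[x0 xv _ ow _] g].
  have /sel : x \in B by rewrite eB ow ov eqxx andbT; lia.
  by rewrite -/(dominated x v) (dominated_outranks x0 xv vN ow).2 g.
have [|B hB eB] := pm2 v; first by rewrite v0.
exists B => //; rewrite mem_filter eB v0 vN eqxx !andbT.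
apply/allP => v'; rewrite eB => /andP[/andP[v0' vN'] /eqP ow]; rewrite -/(dominated v' v).
have [lt|lt|->] := ltngtP v v'; last first.
- by rewrite /dominated eqxx implybb orbT.
- rewrite (dominated_outranks v0' lt vN ow).2; apply/negP => g.
  have [z v'z azv] := arc_before v0' lt vN ow.
  case/negP: ng; apply/hasP; exists z; rewrite ?azv ?mem_iota /=.
    by case/arcP: azv; lia.
  by apply: leq_trans g _; rewrite leq_mul2l leq_sub2r ?orbT.
have ow' := esym ow; rewrite (dominated_outranks v0 lt vN' ow').1; apply: contraT => ngd.
have [z zv' avz] := arc_after v0 lt vN' ow'.
case/negP: nb; apply/hasP; exists z; rewrite ?avz ?mem_iota /=.
  by case/arcP: avz; lia.
apply: contra ngd => g; apply: leq_trans g; rewrite leq_mul2l leq_sub2l ?orbT //.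
Qed.

(** * Paths and the entries of K *)

(** Rows are counted from the top, as in [K_entry]. *)
Definition row_x p t : nat := xcoord (word p) (a * n + 1 - t).

Definition valley p t : bool := (t < a * n) && (row_x p t.+1 < row_x p t).

Lemma up_pos1 p : up_pos (word p) 1 = 1.
Proof.
have N0 : 0 < N by lia.
have := @up_pos_ups (word p) 1; rewrite size_word letter1 upsS ?size_word // letter1.
by rewrite /ups take0; apply.
Qed.

Lemma up_pos_lt p m m' : 0 < m -> m < m' -> m' <= a * n ->
  up_pos (word p) m < up_pos (word p) m'.
Proof.
by move=> m0 mm' m'a; rewrite ltn_up_pos ?ups_up_pos ?size_up_positions //; lia.
Qed.

Lemma leq_xcoord p m m' : 0 < m -> m <= m' -> m' <= a * n ->
  xcoord (word p) m <= xcoord (word p) m'.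
Proof.
move=> m0; rewrite leq_eqVlt => /orP[/eqP-> //|mm' m'a].
have [_ _ _ <- _] := @up_posP p m ltac:(lia).
have [_ _ _ <- _] := @up_posP p m' ltac:(lia).
by apply: leq_rights; have := up_pos_lt p m0 mm' m'a; lia.
Qed.

Lemma xcoord_above p m : 0 < m <= a * n -> a * xcoord (word p) m <= b * m.-1.
Proof.
move=> ma; have [/andP[u0 uN] _ eu er _] := up_posP p ma.
by rewrite -eu -er dyck_above //; lia.
Qed.

Lemma leq_row_x p t t' : 0 < t -> t <= t' -> t' <= a * n -> row_x p t' <= row_x p t.
Proof. by move=> t0 tt' ta; apply: leq_xcoord; lia. Qed.

Lemma row_x_last p : row_x p (a * n) = 0.
Proof. by rewrite /row_x addKn /xcoord up_pos1. Qed.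

Lemma row_x_le p t : 0 < t <= a * n -> row_x p t <= b * n.
Proof.
move=> ta; have := @xcoord_above p (a * n + 1 - t) ltac:(lia); rewrite -/(row_x p t) => h.
suff : a * row_x p t <= a * (b * n) by rewrite leq_pmul2l.
by apply: leq_trans h _; rewrite mulnCA leq_mul2l; lia.
Qed.

Lemma K_entryE p t : 0 < t <= a * n ->
  K_entry p t = if valley p t then b * n - row_x p t + 1 else bar a b n t.
Proof.
move=> ta; rewrite /K_entry -/(row_x p t); congr (if _ then _ else _).
have [t1|ta'] := leqP (a * n) t.
  have -> : t = a * n by lia.
  by rewrite addKn up_pos1 /valley !ltnn.
rewrite /valley ta' /= /row_x.
set m := a * n + 1 - t; have -> : a * n + 1 - t.+1 = m.-1 by rewrite /m; lia.
have m1 : 1 < m by rewrite /m; lia.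
have ma : m <= a * n by rewrite /m; lia.
have [/andP[u0 uN] lu eu er ex] := @up_posP p m ltac:(lia).
have [/andP[u0' uN'] lu' eu' er' ex'] := @up_posP p m.-1 ltac:(lia).
have lt : up_pos (word p) m.-1 < up_pos (word p) m by apply: up_pos_lt; lia.
rewrite (_ : 1 < _) /=; last by lia.
have [l|l] := boolP (letter (word p) (up_pos (word p) m).-1); last first.
  have ne : up_pos (word p) m.-1 <> (up_pos (word p) m).-1.
    by move=> e; rewrite -e lu' in l.
  by apply/esym; lia.
have := @up_pos_ups (word p) (up_pos (word p) m).-1; rewrite eu size_word => h.
by have := h ltac:(lia) l => e; apply/esym/negbTE; lia.
Qed.

Lemma valley_gt0 p t : valley p t -> 0 < row_x p t.
Proof. by case/andP => _; apply: leq_ltn_trans. Qed.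

Lemma valley_inj p t t' : 0 < t -> 0 < t' -> valley p t -> valley p t' ->
  row_x p t = row_x p t' -> t = t'.
Proof.
move=> t0 t0' /andP[ta lt] /andP[ta' lt'] e.
case: (ltngtP t t') => // h.
  by have := @leq_row_x p t.+1 t' isT h (ltnW ta'); lia.
by have := @leq_row_x p t'.+1 t isT h (ltnW ta); lia.
Qed.

Lemma mem_K p v :
  (v \in K_seq p) = has (fun t => v == if valley p t then b * n - row_x p t + 1
                                       else bar a b n t) (iota 1 (a * n)).
Proof.
apply/mapP/hasP => [[t ta ->]|[t ta /eqP->]]; exists t => //;
  by rewrite K_entryE //; move: ta; rewrite mem_iota; lia.
Qed.

Lemma K_bounds p v : v \in K_seq p -> 0 < v <= N.
Proof.
rewrite mem_K => /hasP[t]; rewrite mem_iota => ta /eqP->; rewrite /bar.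
by case: ifP => _; lia.
Qed.

Lemma mem_K_bar p t : 0 < t <= a * n -> (bar a b n t \in K_seq p) = ~~ valley p t.
Proof.
move=> ta; rewrite mem_K; apply/hasP/idP => [[t' ta' /eqP]|nv]; last first.
  by exists t; rewrite ?mem_iota ?(negbTE nv) //; lia.
move: ta'; rewrite mem_iota => ta'; case: ifP => [v'|nv' e].
  by have := valley_gt0 v'; rewrite /bar; lia.
by have -> : t = t' by [move: e; rewrite /bar; lia]; rewrite nv'.
Qed.

Lemma mem_K_column p v : v <= b * n ->
  (v \in K_seq p) =
  has (fun t => valley p t && (v == b * n - row_x p t + 1)) (iota 1 (a * n)).
Proof.
move=> vb; rewrite mem_K; apply: eq_in_has => t; rewrite mem_iota => ta.
by case: ifP => //= _; apply/negbTE; rewrite /bar; lia.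
Qed.

Lemma rows_K p i : i <= a * n ->
  rows_upto (mem (K_seq p)) i = \sum_(1 <= t < i.+1) valley p t.
Proof.
move=> ia; apply: eq_big_nat => t /andP[t0 ti].
by rewrite /= mem_K_bar ?negbK //; lia.
Qed.

Lemma columns_K p k : k <= b * n ->
  columns_upto (mem (K_seq p)) k =
  \sum_(1 <= t < (a * n).+1) (valley p t && (b * n - k < row_x p t)).
Proof.
move=> kb; rewrite /columns_upto.
transitivity (\sum_(1 <= v < k.+1) \sum_(1 <= t < (a * n).+1)
    (valley p t && (v == b * n - row_x p t + 1) && (0 < t))).
  apply: eq_big_nat => v /andP[v0 vk]; rewrite sum_bool_uniq.
    rewrite /= mem_K_column; last by lia.
    congr (nat_of_bool _); apply: eq_in_has => t; rewrite mem_iota => /andP[-> _].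
    by rewrite andbT.
  move=> t t' /andP[/andP[vt /eqP e] t0] /andP[/andP[vt' /eqP e'] t0'].
  apply: (@valley_inj p) => //.
  have ta : t <= a * n by case/andP: (vt) => /ltnW.
  have ta' : t' <= a * n by case/andP: (vt') => /ltnW.
  have := @row_x_le p t ltac:(lia); have := @row_x_le p t' ltac:(lia); lia.
rewrite exchange_big; apply: eq_big_nat => t ta.
rewrite (@sum_bool_uniq (fun v => valley p t && (v == _) && _)); last first.
  by move=> v v' /andP[/andP[_ /eqP->] _] /andP[/andP[_ /eqP->] _].
congr (nat_of_bool _); case: (boolP (valley p t)) => [vt|_]; last first.
  by apply/hasP => -[].
have := valley_gt0 vt; have := @row_x_le p t ltac:(lia) => xb x0.
apply/hasP/idP => [[v]|lt]; first by rewrite mem_iota => vk /= /andP[/eqP e _]; lia.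
exists (b * n - row_x p t + 1); rewrite ?mem_iota ?eqxx /=; lia.
Qed.

(** The rows that reach beyond a given column are the topmost ones, so that
    counting valleys by columns reduces to counting them by rows. *)
Lemma columns_K_threshold p k : k <= b * n -> exists i,
  [/\ i <= a * n,
      forall t, 0 < t <= a * n -> (b * n - k < row_x p t) = (t <= i),
      0 < i -> valley p i
    & columns_upto (mem (K_seq p)) k = rows_upto (mem (K_seq p)) i].
Proof.
move=> kb; set c := b * n - k.
pose P i := (i == 0) || (i <= a * n) && (c < row_x p i).
have exP : exists i, P i by exists 0.
have leP i : P i -> i <= a * n by case/orP => [/eqP->|/andP[]].
case: (ex_maxnP exP leP) => i Pi mx; have ia := leP i Pi.
have thr t : 0 < t <= a * n -> (c < row_x p t) = (t <= i).
  move=> ta; apply/idP/idP => [lt|ti]; first by apply: mx; rewrite /P lt; lia.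
  have ci : c < row_x p i by move: Pi; rewrite /P => /orP[/eqP|/andP[]]; lia.
  by apply: leq_trans ci (leq_row_x _ _ _ _); lia.
exists i; split=> // [i0|].
  have ci : c < row_x p i by rewrite thr ?leqnn //; lia.
  have ia' : i < a * n.
    by rewrite ltn_neqAle ia andbT; apply: contraTneq ci => ->; rewrite row_x_last.
  rewrite /valley ia' /=; apply: leq_ltn_trans ci.
  by rewrite leqNgt thr ?ltnn.
rewrite columns_K // rows_K // (@big_cat_nat _ _ _ i.+1) //= -/c.
rewrite [X in _ + X]big_nat [X in _ + X]big1 ?addn0.
  by apply: eq_big_nat => t ti; rewrite (_ : c < row_x p t) ?andbT // thr; lia.
move=> t ti; have -> : (c < row_x p t) = false by rewrite thr; lia.
by rewrite andbF.
Qed.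

Lemma rows_mono S i i' : i <= i' -> rows_upto S i <= rows_upto S i'.
Proof.
by move=> ii; rewrite /rows_upto [X in _ <= X](@big_cat_nat _ _ _ i.+1) //= leq_addr.
Qed.

Lemma columns_mono S k k' : k <= k' -> columns_upto S k <= columns_upto S k'.
Proof.
by move=> kk; rewrite /columns_upto [X in _ <= X](@big_cat_nat _ _ _ k.+1) //= leq_addr.
Qed.

Lemma rows_valley p i : i < a * n ->
  rows_upto (mem (K_seq p)) i.+1 = rows_upto (mem (K_seq p)) i + valley p i.+1.
Proof. by move=> ia; rewrite (rows_K p ia) (rows_K p (ltnW ia)) big_nat_recr. Qed.

Lemma K_filter p k t : 0 < k <= b * n -> 0 < t <= a * n ->
  (rows_upto (mem (K_seq p)) t.-1 < columns_upto (mem (K_seq p)) k) =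
  (b * n - k < row_x p t).
Proof.
move=> kb ta; have [|i [ia -> // vi ->]] := @columns_K_threshold p k; first by lia.
have [ti|it] := leqP t i; last by rewrite ltnNge rows_mono //; lia.
apply: (@leq_ltn_trans (rows_upto (mem (K_seq p)) i.-1)); first by apply: rows_mono; lia.
case: i ia vi ti => [|i] ia vi ti /=; first by lia.
by rewrite rows_valley // vi // addn1.
Qed.

(** The right hand side says that no minimal box of the filter lies weakly above
    and to the left of the box in row [t] and in column [k] from the right, see
    [mem_minimal]. *)
Lemma K_ideal p k t : 0 < k <= b * n -> 0 < t <= a * n ->
  (rows_upto (mem (K_seq p)) t <= columns_upto (mem (K_seq p)) k.-1) =
  ~~ has (fun t' => valley p t' && (row_x p t' <= b * n - k.-1)) (iota 1 t).
Proof.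
move=> kb ta; have [|i [ia thr vi ->]] := @columns_K_threshold p k.-1; first by lia.
apply/idP/hasPn => [le t'|none].
  rewrite mem_iota => t't; apply/negP => /andP[vt']; rewrite leqNgt thr; last by lia.
  rewrite -ltnNge => it'; move: le; rewrite leqNgt => /negP[].
  apply: (@leq_trans (rows_upto (mem (K_seq p)) t')); last by apply: rows_mono; lia.
  case: t' t't vt' it' => // t' t't vt' it'; rewrite rows_valley ?vt' ?addn1; last by lia.
  by apply: rows_mono.
elim: t ta none => [|t IH] ta none; first by rewrite /rows_upto big_geq.
have [ti|it] := leqP t.+1 i; first exact: rows_mono.
rewrite rows_valley; last by lia.
have := none t.+1; rewrite mem_iota [row_x _ _ <= _]leqNgt thr // -ltnNge it andbT.
move=> /(_ ltac:(lia)) /negbTE->.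
rewrite addn0; case: (posnP t) => [->|t0]; first by rewrite /rows_upto big_geq.
by apply: IH => [|t']; [lia | rewrite mem_iota => t't; apply: none; rewrite mem_iota; lia].
Qed.

Lemma K_balanced p :
  rows_upto (mem (K_seq p)) (a * n) = columns_upto (mem (K_seq p)) (b * n).
Proof.
rewrite rows_K // columns_K // subnn; apply: eq_big_nat => t _.
by case: (boolP (valley p t)) => // /valley_gt0 ->.
Qed.

(** * Filters and rowmotion *)

Implicit Types B C : box a b n.

Lemma mem_filter_row p B :
  (B \in filter_of p) = (B.1 < row_x p (a * n - B.2)).
Proof. by rewrite inE /row_x (_ : _ - _ = B.2.+1) //; have := ltn_ord B.2; lia. Qed.

Lemma filter_sub p : filter_of p \subset boxes a b n.
Proof.
apply/subsetP => B; rewrite !inE => lt.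
have := @xcoord_above p B.2.+1 (ltn_ord B.2); apply: leq_trans.
by rewrite leq_mul2l lt orbT.
Qed.

Lemma box_coords B :
  [/\ 0 < b * n - B.1 <= b * n, 0 < a * n - B.2 <= a * n,
      b * n - (b * n - B.1) = B.1 & b * n - (b * n - B.1).-1 = B.1.+1].
Proof. by have := ltn_ord B.1; have := ltn_ord B.2; split; lia. Qed.

Lemma mem_filter_K p B :
  (B \in filter_of p) =
  (rows_upto (mem (K_seq p)) (a * n - B.2).-1 < columns_upto (mem (K_seq p)) (b * n - B.1)).
Proof. by have [k0 t0 e _] := box_coords B; rewrite mem_filter_row K_filter // e. Qed.

(** The boxes in the corners of the valleys. *)
Lemma mem_minimal p C :
  (C \in minimal_elements (filter_of p)) =
  valley p (a * n - C.2) && (row_x p (a * n - C.2) == C.1.+1).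
Proof.
have lt1 := ltn_ord C.1; have lt2 := ltn_ord C.2.
have eC : row_x p (a * n - C.2) = xcoord (word p) C.2.+1.
  by rewrite /row_x; congr xcoord; lia.
have eC' : row_x p (a * n - C.2).+1 = xcoord (word p) C.2.
  by rewrite /row_x; congr xcoord; lia.
rewrite inE /valley eC eC'; apply/andP/andP => [[CF /forall_inP mn]|[/andP[ta lt] /eqP e]].
  have xC : xcoord (word p) C.2.+1 = C.1.+1.
    move: (CF); rewrite inE leq_eqVlt => /orP[/eqP//|lt].
    have xb := @row_x_le p (a * n - C.2) ltac:(lia); rewrite eC in xb.
    have C1b : C.1.+1 < b * n by apply: leq_trans lt xb.
    have := mn (Ordinal C1b, C.2); rewrite inE /= lt /box_le /= leqnSn leqnn => /(_ isT).
    by move=> /eqP e; have := congr1 (fun D : box a b n => nat_of_ord D.1) e => /=; lia.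
  rewrite xC eqxx; split=> //.
  have C20 : 0 < C.2.
    by rewrite lt0n; apply/eqP => C20; move: xC; rewrite C20 /xcoord up_pos1.
  have -> : a * n - C.2 < a * n by lia.
  rewrite /= ltnNge; apply/negP => ge.
  have C2b : C.2.-1 < a * n by lia.
  have := mn (C.1, Ordinal C2b); rewrite inE /= prednK // ge /box_le /= leqnn leq_pred.
  move=> /(_ isT) /eqP e.
  by have := congr1 (fun D : box a b n => nat_of_ord D.2) e => /=; lia.
split; first by rewrite inE e.
apply/forall_inP => D; rewrite inE => DF; apply/implyP => /andP[CD1 CD2].
have e2 : D.2 = C.2 :> nat.
  apply/eqP; rewrite eqn_leq CD2 leqNgt; apply/negP => lt2'.
  have h := @leq_xcoord p D.2.+1 C.2 isT lt2' (ltnW lt2).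
  rewrite e ltnS in lt; have := leq_trans (leq_trans DF h) lt.
  by rewrite ltnNge CD1.
have e1 : D.1 = C.1 :> nat.
  by apply/eqP; rewrite eqn_leq CD1 andbT -ltnS -e -e2.
case: D C e1 e2 {lt1 lt2 eC eC' ta lt e DF CD1 CD2} => [D1 D2] [C1 C2] /=.
by move=> /val_inj-> /val_inj->.
Qed.

Lemma mem_rowmotion p B :
  (B \in filter_of (rowmotion p)) =
  (B \in boxes a b n) &&
  (rows_upto (mem (K_seq p)) (a * n - B.2) <=
   columns_upto (mem (K_seq p)) (b * n - B.1).-1).
Proof.
have [k0 t0 _ e] := box_coords B.
rewrite rowmotionP in_setD andbC; case: (boolP (B \in boxes a b n)) => // Bb.
rewrite K_ideal // e inE Bb; congr (~~ _).
apply/exists_inP/hasP => [[C]|[t]].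
  case: C => i j; rewrite mem_minimal => /andP[/= vC /eqP xC] /andP[/= BC1 BC2].
  exists (a * n - j); first by rewrite mem_iota; have := ltn_ord j; lia.
  by rewrite vC xC ltnS.
rewrite mem_iota => tB /andP[vt xt].
have xt0 := valley_gt0 vt; have xb := @row_x_le p t ltac:(lia).
have i1 : (row_x p t).-1 < b * n by lia.
have i2 : a * n - t < a * n by lia.
exists (Ordinal i1, Ordinal i2).
  by rewrite mem_minimal /= subKn ?vt ?prednK ?eqxx //; lia.
by rewrite /box_le /=; lia.
Qed.

(** * Sets of entries *)

Lemma discrete_ivt (f : nat -> nat) m y :
  f 0 = 0 -> (forall i, i < m -> f i.+1 <= f i + 1) -> y <= f m ->
  exists2 i, i <= m & f i = y.
Proof.
move=> f0; elim: m => [|m IH] step ym; first by exists 0 => //; lia.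
have [ym'|my] := leqP y (f m).
  by have [i im fi] := IH (fun i im => step i (ltnW im)) ym'; exists i => //; apply: leqW.
by exists m.+1 => //; have := step m (ltnSn m); lia.
Qed.

Lemma rows_succ S i : rows_upto S i.+1 = rows_upto S i + ~~ S (bar a b n i.+1).
Proof. by rewrite /rows_upto big_nat_recr. Qed.

Lemma columns_succ S k : columns_upto S k.+1 = columns_upto S k + S k.+1.
Proof. by rewrite /columns_upto big_nat_recr. Qed.

Lemma rows0 S : rows_upto S 0 = 0.
Proof. by rewrite /rows_upto big_geq. Qed.

Lemma columns0 S : columns_upto S 0 = 0.
Proof. by rewrite /columns_upto big_geq. Qed.

(** Both counts start at 0, grow by steps of at most 1 and have the same final
    value. So if the count of columns grows at [k], the count of rows takes its
    old value at some [i], where the comparison changes; likewise for rows. *)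
Lemma balanced_eq (S S' : pred nat) :
    rows_upto S (a * n) = columns_upto S (b * n) ->
    rows_upto S' (a * n) = columns_upto S' (b * n) ->
    (forall k t, 0 < k <= b * n -> 0 < t <= a * n ->
      (rows_upto S t.-1 < columns_upto S k) = (rows_upto S' t.-1 < columns_upto S' k)) ->
  forall v, 0 < v <= N -> S v = S' v.
Proof.
have column (T T' : pred nat) k :
    rows_upto T (a * n) = columns_upto T (b * n) ->
    (forall k t, 0 < k <= b * n -> 0 < t <= a * n ->
      (rows_upto T t.-1 < columns_upto T k) = (rows_upto T' t.-1 < columns_upto T' k)) ->
    k < b * n -> T k.+1 -> T' k.+1.
  move=> bT e kb Tk; have sk := columns_succ T k; rewrite Tk addn1 in sk.
  have le := columns_mono T kb.
  have [i _||i ia ei] := @discrete_ivt (rows_upto T) (a * n) (columns_upto T k) (rows0 T).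
  - by rewrite rows_succ leq_add2l; case: (T _).
  - by lia.
  have {}ia : i < a * n.
    by rewrite ltn_neqAle ia andbT; apply/eqP => h; rewrite h in ei; lia.
  have := e k.+1 i.+1 ltac:(lia) ltac:(lia); rewrite /= ei sk ltnSn => /esym lt.
  have : ~~ (rows_upto T' i < columns_upto T' k).
    case: k kb {Tk sk le lt} ei => [|k] kb ei; first by rewrite columns0.
    by have := e k.+1 i.+1 ltac:(lia) ltac:(lia); rewrite /= ei ltnn => <-.
  by move: lt; rewrite columns_succ; case: (T' k.+1); lia.
have row (T T' : pred nat) t :
    rows_upto T (a * n) = columns_upto T (b * n) ->
    rows_upto T' (a * n) = columns_upto T' (b * n) ->
    (forall k t, 0 < k <= b * n -> 0 < t <= a * n ->
      (rows_upto T t.-1 < columns_upto T k) = (rows_upto T' t.-1 < columns_upto T' k)) ->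
    t < a * n -> ~~ T (bar a b n t.+1) -> ~~ T' (bar a b n t.+1).
  move=> bT bT' e ta Tt; have st := rows_succ T t; rewrite Tt addn1 in st.
  have le := rows_mono T ta.
  have [i _||k kb ek] :=
    @discrete_ivt (columns_upto T) (b * n) (rows_upto T t.+1) (columns0 T).
  - by rewrite columns_succ leq_add2l; case: (T _).
  - by lia.
  have k0 : 0 < k by rewrite lt0n; apply/eqP => h; rewrite h columns0 in ek; lia.
  have := e k t.+1 ltac:(lia) ltac:(lia); rewrite /= ek st ltnSn => /esym lt.
  have : columns_upto T' k <= rows_upto T' t.+1.
    have [ta'|at'] := ltnP t.+1 (a * n).
      by have := e k t.+2 ltac:(lia) ltac:(lia); rewrite /= ek ltnn => h; rewrite leqNgt -h.
    have -> : t.+1 = a * n by lia.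
    by rewrite bT' columns_mono.
  by move: lt; rewrite rows_succ; case: (T' _); lia.
move=> bS bS' e v vN; have e' k t kb ta := esym (e k t kb ta).
have [vb|bv] := leqP v (b * n).
  case: v vN vb => // v vN vb.
  by apply/idP/idP; [apply: (column S S') | apply: (column S' S)].
have [t ta ->] : exists2 t, t < a * n & v = bar a b n t.+1.
  by exists (N - v); rewrite /bar; lia.
by apply: negb_inj; apply/idP/idP; [apply: (row S S') | apply: (row S' S)].
Qed.

Lemma K_seq_inj p p' : K_seq p =i K_seq p' -> p = p'.
Proof.
move=> e; apply: filter_of_inj; apply/setP => B; rewrite !mem_filter_K.
have er i : rows_upto (mem (K_seq p)) i = rows_upto (mem (K_seq p')) i.
  by apply: eq_bigr => t _; rewrite /= e.
have ec i : columns_upto (mem (K_seq p)) i = columns_upto (mem (K_seq p')) i.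
  by apply: eq_bigr => t _; rewrite /= e.
by rewrite er ec.
Qed.

(** * The inverse matching map *)

(** Rowmotion and inverse promotion both amount to toggling every box once, the
    boxes of a column from top to bottom. Rowmotion takes the columns from left
    to right, and inverse promotion from right to left. Letting each column lag
    by its distance from the right border turns one sweep into the other. *)
Definition matching_filter q : {set box a b n} :=
  [set B : box a b n | B \in filter_of (iter (b * n - B.1) (@promotion a b n) q)].

Lemma in_matching_filter q B :
  (B \in matching_filter q) =
  (B \in filter_of (iter (b * n - B.1) (@promotion a b n) q)).
Proof. exact: in_set. Qed.

Lemma mem_matching_filter q B :
  (B \in matching_filter q) =
  (B.1 < arcs_within (word q) (b * n - B.1) (N + 1 - (a * n - B.2))).
Proof.
have lt1 := ltn_ord B.1; have lt2 := ltn_ord B.2.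
rewrite !inE arcs_iter; last by lia.
set p := iter _ _ _; have -> : N + 1 - (a * n - B.2) - (b * n - B.1) = B.1 + B.2.+1 by lia.
have := @ltn_up_pos (word p) B.2.+1 (B.1 + B.2.+1); rewrite size_up_positions => /(_ lt2) h.
have := @ups_rights (word p) (B.1 + B.2.+1); rewrite size_word => /(_ ltac:(lia)) e.
by rewrite /xcoord; move: h; case: ltnP; case: ltnP; lia.
Qed.

Lemma mem_matching_filter_unbeaten q B :
  (B \in matching_filter q) =
  (rows_upto (unbeaten (word q)) (a * n - B.2).-1 <
   columns_upto (unbeaten (word q)) (b * n - B.1)).
Proof.
by have [k0 t0 e _] := box_coords B; rewrite unbeaten_window // mem_matching_filter e.
Qed.

Lemma matching_filter_path q : exists p, filter_of p == matching_filter q.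
Proof.
have [| B C | p e] := @filter_of_surj a b n (matching_filter q);
  last by exists p; apply/eqP.
  by apply/subsetP => B; rewrite inE => /(subsetP (filter_sub _)).
rewrite !mem_matching_filter_unbeaten => lt _ /andP[BC1 BC2].
apply: leq_trans (leq_trans lt (columns_mono _ _)); last by lia.
by rewrite ltnS rows_mono //; lia.
Qed.

Definition matching_inv q : dyck a b n := xchoose (matching_filter_path q).

Lemma filter_matching_inv q : filter_of (matching_inv q) = matching_filter q.
Proof. exact/eqP/(xchooseP (matching_filter_path q)). Qed.

Lemma K_matching_inv q : K_seq (matching_inv q) =i selected q.
Proof.
move=> v; rewrite mem_selected.
have [vN|nvN] := boolP (0 < v <= N); last first.
  rewrite (contraNF (@K_bounds _ v) nvN); apply/esym/negbTE; apply: contra nvN.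
  by case/and4P => -> ->.
apply: (@balanced_eq (mem (K_seq (matching_inv q)))) => // [||k t kb ta].
- exact: K_balanced.
- exact: unbeaten_balanced.
have i1 : b * n - k < b * n by lia.
have i2 : a * n - t < a * n by lia.
have := mem_matching_filter_unbeaten q (Ordinal i1, Ordinal i2).
rewrite -filter_matching_inv mem_filter_K /= !subKn //; lia.
Qed.

(** A box lies above the image of [q] iff its window has enough arcs
    ([unbeaten_window]), and above the rowmotion of the image of the promotion of
    [q] iff the window moved one place to the left has enough arcs of the
    promotion of [q] ([unbeaten_window_rowmotion]). These are the same arcs. *)
Lemma rowmotion_matching_inv q :
  rowmotion (matching_inv (promotion q)) = matching_inv q.
Proof.
apply: filter_of_inj; apply/setP => B0; move: (B0 : box a b n) => B {B0}.
rewrite mem_rowmotion filter_matching_inv.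
have e := K_matching_inv (promotion q).
have er i : rows_upto (mem (K_seq (matching_inv (promotion q)))) i =
            rows_upto (unbeaten (word (promotion q))) i.
  by apply: eq_bigr => t _; rewrite /= e mem_selected.
have ec i : columns_upto (mem (K_seq (matching_inv (promotion q)))) i =
            columns_upto (unbeaten (word (promotion q))) i.
  by apply: eq_bigr => t _; rewrite /= e mem_selected.
rewrite er ec; have [Bb|nB] := boolP (B \in boxes a b n); last first.
  by apply/esym/negbTE; apply: contra nB; rewrite inE => /(subsetP (filter_sub _)).
have [k0 t0 eB _] := box_coords B.
rewrite unbeaten_window_rowmotion //; last first.
  move: Bb; rewrite inE => Bb; have lt1 := ltn_ord B.1; have lt2 := ltn_ord B.2.
  have -> : b * n - B.1 - 1 = b * n - B.1.+1 by lia.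
  by rewrite !mulnBr (mulnCA a b) leq_sub2l.
have rN : N - (a * n - B.2) < N by lia.
rewrite arcs_promotion // mem_matching_filter eB prednK; last by lia.
by congr (_ < arcs_within _ _ _); lia.
Qed.

Lemma iter_rowmotion_matching_inv q k :
  iter k (@rowmotion a b n) (matching_inv (iter k (@promotion a b n) q)) = matching_inv q.
Proof. by elim: k => // k IH; rewrite iterSr iterS rowmotion_matching_inv. Qed.

Lemma matching_inv_inj : injective matching_inv.
Proof.
have column q B : (B \in filter_of q) =
    (B \in filter_of (iter (b * n - B.1) (@rowmotion a b n) (matching_inv q))).
  set k := b * n - B.1; pose r := iter k (@promotion_inv a b n) q.
  have er : iter k (@promotion a b n) r = q.
    rewrite /r; elim: (k) => // j IH.
    by rewrite iterSr [iter j.+1 _ q]iterS /promotion_inv f_invF.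
  rewrite -[in RHS]er iter_rowmotion_matching_inv filter_matching_inv.
  by rewrite in_matching_filter -/k er.
by move=> q q' e; apply: filter_of_inj; apply/setP => B; rewrite column e -column.
Qed.

End Dyck.

Theorem theorem7p13 (a b n : nat) (ha : 0 < a) (hb : 0 < b)
    (hab : coprime a b) (hn : 1 <= n) :
  (exists Mat : dyck a b n -> dyck a b n, matching_map Mat)
  /\ (forall Mat : dyck a b n -> dyck a b n, matching_map Mat ->
        Mat \o @rowmotion a b n =1 @promotion_inv a b n \o Mat).
Proof.
have KM := K_matching_inv ha hb hn; split.
  have [Mat MK KMat] := injF_bij (@matching_inv_inj a b n ha hb hn).
  by exists Mat; exists (matching_inv ha hb hn).
move=> Mat [Matinv [MatK MatinvK K]] p /=.
have eM q : Matinv q = matching_inv ha hb hn q.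
  by apply: (@K_seq_inj a b n ha hb hn) => v; rewrite K KM.
set q := promotion_inv (Mat p).
have -> : rowmotion p = Matinv q.
  rewrite eM -rowmotion_matching_inv -eM /q /promotion_inv f_invF.
  by rewrite MatK.
exact: MatinvK.
Qed.
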